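(* Let $V$ be a totally geodesic lightlike hypersurface of a pseudo-Riemannian manifold $(M,g)$ of Lorentzian signature. Then the second fundamental tensor of $V$ vanishes. For any choice of isotropic normalization of $V$, an affine connection is induced on $V$, and the curvature tensor of this connection is completely determined by the curvature tensor of the manifold $(M,g)$.
   Context: $(M,g)$ has dimension $n$ and signature $(n-1,1)$, with Levi-Civita connection $D$. A lightlike hypersurface $V$ is a hypersurface ($\dim V=n-1$) whose tangent hyperplanes are tangent to the isotropic cones of $(M,g)$; equivalently, $g$ restricted to $V$ has rank $n-2$. A first-order isotropic frame at $x\in V$ is a basis $(e_1,\dots,e_n)$ of $T_xM$ with $e_1$ isotropic, $T_xV=\mathrm{span}(e_1,\dots,e_{n-1})$, $e_a$ ($a,b\in\{2,\dots,n-1\}$) spacelike and orthogonal to $e_1$, $g_{ab}=(e_a,e_b)$ positive definite, $e_n$ isotropic, $(e_1,e_n)=-1$, $(e_a,e_n)=0$. Write $dx=\omega^ie_i$, $De_i=\omega_i^je_j$. On $V$: $\omega^n=0$ and $\omega^n_a=\lambda_{ab}\omega^b$, $\lambda_{ab}=\lambda_{ba}$; $\lambda_{ab}$ is the second fundamental tensor of $V$. $V$ is totally geodesic if the equations of geodesics of $(M,g)$ are identically satisfied on it, i.e. every geodesic of $(M,g)$ starting at a point of $V$ in a direction tangent to $V$ stays (locally) in $V$. An isotropic normalization of $V$ is a field $N$ of isotropic directions $N_x\not\subset T_xV$ (equivalently, a screen distribution $S_x=N_x^{\perp}\cap T_xV$); frames are then adapted so that $e_n\in N_x$ and $e_a\in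 S_x$. The induced affine connection on $V$ is the one whose connection forms are $\omega^i_j$, $i,j\in\{1,\dots,n-1\}$, in such frames, i.e. the projection of $D_XY$ ($X,Y$ tangent to $V$) onto $T_xV$ along $N_x$. *)

(* Defs.v *)
From HB Require Import structures.
From mathcomp Require Export all_boot all_order all_algebra.
From mathcomp Require Export all_classical all_reals all_analysis.
Set Implicit Arguments.
Unset Strict Implicit.
Unset Printing Implicit Defensive.
Import Order.TTheory GRing.Theory Num.Theory.
Import numFieldNormedType.Exports.
#[export] Set Implicit Arguments.
#[export] Unset Strict Implicit.
#[export] Unset Printing Implicit Defensive.
Local Open Scope classical_set_scope.
Local Open Scope ring_scope.

(* Conventions.  Vectors are row vectors; the differential of f at u acts by
   X |-> X *m 'J f u.  A tensor (or connection) on a manifold is the family of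
   its components in the charts of the atlas, each a function of the
   coordinates, subject to the classical transformation law.  Values of such
   functions outside the image of the chart carry no information. *)

Section Smooth.
Context {R : realType} {m : nat} {W : normedModType R}.

(* For U open: class C^k on U, by induction on directional derivatives. *)
Fixpoint Ck_on (k : nat) (U : set 'rV[R]_m) (f : 'rV[R]_m -> W) : Prop :=
  (forall u, U u -> {for u, continuous f}) /\
  if k is k'.+1 then
    forall v, (forall u, U u -> derivable f u v) /\
              Ck_on k' U (fun u => 'D_v f u)
  else True.

Definition smooth_on (U : set 'rV[R]_m) (f : 'rV[R]_m -> W) : Prop :=
  forall k, Ck_on k U f.

End Smooth.

Record manifold (R : realType) (m : nat) := Manifold {
  point_of :> topologicalType ;
  chart : Type ;
  dom : chart -> set point_of ;
  coord : chart -> point_of -> 'rV[R]_m ;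
  param : chart -> 'rV[R]_m -> point_of ;
  manifold_hausdorff : hausdorff_space point_of ;
  manifold_second_countable : @second_countable point_of ;
  dom_cover : forall x, exists c, dom c x ;
  dom_open : forall c, open (dom c) ;
  cod_open : forall c, open (coord c @` dom c) ;
  coordK : forall c x, dom c x -> param c (coord c x) = x ;
  coord_continuous : forall c x, dom c x -> {for x, continuous (coord c)} ;
  param_continuous : forall c u, (coord c @` dom c) u ->
    {for u, continuous (param c)} ;
  transition_smooth : forall c d,
    smooth_on (coord c @` (dom c `&` dom d)) (coord d \o param c) }.

Arguments chart {R m} _.
Arguments dom {R m} _ _ _.
Arguments coord {R m} _ _ _.
Arguments param {R m} _ _ _.

Definition cod (R : realType) (m : nat) (M : manifold R m) (c : chart M) :
  set 'rV[R]_m := coord M c @` dom M c.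

Definition transition (R : realType) (m : nat) (M : manifold R m)
  (c d : chart M) : 'rV[R]_m -> 'rV[R]_m := coord M d \o param M c.

Definition overlap (R : realType) (m : nat) (M : manifold R m)
  (c d : chart M) : set 'rV[R]_m := coord M c @` (dom M c `&` dom M d).

Definition ip (R : realType) (m : nat) (G : 'M[R]_m) (v w : 'rV[R]_m) : R :=
  (v *m G *m w^T) 0 0.

(* Signature (m, 1) in dimension m + 1. *)
Definition lorentz_form (R : realType) (m : nat) (G : 'M[R]_m.+1) : Prop :=
  exists2 P : 'M[R]_m.+1, P \in unitmx &
    P *m G *m P^T =
      diag_mx (\row_(i < m.+1) (if i == ord_max then -1 else 1)).

Record lorentz_metric (R : realType) (m : nat) (M : manifold R m.+1) :=
  LorentzMetric {
  metric_comp :> chart M -> 'rV[R]_m.+1 -> 'M[R]_m.+1 ;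
  metric_smooth : forall c, smooth_on (cod c) (metric_comp c) ;
  metric_sym : forall c u, cod c u -> (metric_comp c u)^T = metric_comp c u ;
  metric_signature : forall c u, cod c u -> lorentz_form (metric_comp c u) ;
  metric_change : forall c d u, overlap c d u ->
    metric_comp c u =
      'J (transition c d) u *m metric_comp d (transition c d u)
        *m ('J (transition c d) u)^T }.

(* A k i j is the coefficient Gamma^k_{ij}; this is Gamma(v, w). *)
Definition gamma (R : realType) (m : nat) (A : 'I_m -> 'M[R]_m)
  (v w : 'rV[R]_m) : 'rV[R]_m := \row_k (v *m A k *m w^T) 0 0.

Record affine_connection (R : realType) (m : nat) (M : manifold R m) :=
  AffineConnection {
  conn_coef :> chart M -> 'rV[R]_m -> 'I_m -> 'M[R]_m ;
  conn_smooth : forall c k, smooth_on (cod c) (fun u => conn_coef c u k) ;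
  conn_change : forall c d u v w, overlap c d u ->
    gamma (conn_coef c u) v w *m 'J (transition c d) u =
      'D_v (fun x => w *m 'J (transition c d) x) u +
      gamma (conn_coef d (transition c d u))
        (v *m 'J (transition c d) u) (w *m 'J (transition c d) u) }.

(* Covariant derivative, in the chart d, of a vector field Y along a map F
   (both expressed in coordinates) in the direction X: for F = id this is the
   covariant derivative of vector fields on M. *)
Definition cov (R : realType) (m p : nat) (M : manifold R m)
  (D : affine_connection M) (d : chart M) (F : 'rV[R]_p -> 'rV[R]_m)
  (X : 'rV[R]_p) (Y : 'rV[R]_p -> 'rV[R]_m) (u : 'rV[R]_p) : 'rV[R]_m :=
  'D_X Y u + gamma (D d (F u)) (X *m 'J F u) (Y u).

(* R(X,Y)Z = D_X D_Y Z - D_Y D_X Z - D_[X,Y] Z, evaluated on vectors extended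
   with constant components in the chart c, so that [X,Y] = 0. *)
Definition curvature (R : realType) (m : nat) (M : manifold R m)
  (D : affine_connection M) (c : chart M) (u X Y Z : 'rV[R]_m) : 'rV[R]_m :=
  cov D c id X (cov D c id Y (cst Z)) u - cov D c id Y (cov D c id X (cst Z)) u.

Definition levi_civita (R : realType) (m : nat) (M : manifold R m.+1)
  (g : lorentz_metric M) (D : affine_connection M) : Prop :=
  forall (c : chart M) u, cod c u ->
    (forall v w, gamma (D c u) v w = gamma (D c u) w v) /\
    (forall x v w, 'D_x (fun y => ip (g c y) v w) u =
       ip (g c u) (gamma (D c u) x v) w + ip (g c u) v (gamma (D c u) x w)).

(* crv is a geodesic parametrized by the interval ]-e, e[. *)
Definition geodesic (R : realType) (m : nat) (M : manifold R m)
  (D : affine_connection M) (e : R) (crv : R -> M) : Prop :=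
  0 < e /\ forall t : R, `|t| < e -> {for t, continuous crv} /\
    forall d, dom M d (crv t) ->
      let x := coord M d \o crv in
      [/\ derivable x t 1, derivable (derive1 x) t 1 &
          derive1 (derive1 x) t
            + gamma (D d (x t)) (derive1 x t) (derive1 x t) = 0].

Definition local_expr (R : realType) (p m : nat) (V : manifold R p)
  (M : manifold R m) (i : V -> M) (c : chart V) (d : chart M) :
  'rV[R]_p -> 'rV[R]_m := coord M d \o i \o param V c.

Definition local_dom (R : realType) (p m : nat) (V : manifold R p)
  (M : manifold R m) (i : V -> M) (c : chart V) (d : chart M) :
  set 'rV[R]_p := coord V c @` (dom V c `&` i @^-1` dom M d).

(* Hypersurfaces are immersed; embedded ones are the special case where incl
   is a homeomorphism onto its image. *)
Record hypersurface (R : realType) (m : nat) (M : manifold R m.+1) :=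
  Hypersurface {
  hyp_mfd :> manifold R m ;
  incl : hyp_mfd -> M ;
  incl_continuous : continuous incl ;
  incl_smooth : forall c d,
    smooth_on (local_dom incl c d) (local_expr incl c d) ;
  incl_immersion : forall c d u, local_dom incl c d u ->
    row_free ('J (local_expr incl c d) u) }.

Arguments incl {R m M} _ _.

(* The rows of tangent_mx V c d u are the coordinate tangent vectors of V at
   the point with coordinates u: its row space is the tangent hyperplane. *)
Definition tangent_mx (R : realType) (m : nat) (M : manifold R m.+1)
  (V : hypersurface M) (c : chart V) (d : chart M) (u : 'rV[R]_m) :
  'M[R]_(m, m.+1) := 'J (local_expr (incl V) c d) u.

Definition lightlike (R : realType) (n : nat) (M : manifold R n.+2)
  (g : lorentz_metric M) (V : hypersurface M) : Prop :=
  forall c d u, local_dom (incl V) c d u ->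
    let T := tangent_mx c d u in
    \rank (T *m g d (local_expr (incl V) c d u) *m T^T) = n.

(* "The geodesic stays locally in V" means that it lifts, near t = 0, to a
   continuous curve of V through the given point; if V is embedded this just
   says that crv t belongs to V for t near 0. *)
Definition totally_geodesic (R : realType) (m : nat) (M : manifold R m.+1)
  (D : affine_connection M) (V : hypersurface M) : Prop :=
  forall (e : R) (crv : R -> M) (p : V) (c : chart V) (d : chart M),
    dom V c p -> dom M d (incl V p) ->
    geodesic D e crv -> crv 0 = incl V p ->
    let v := derive1 (coord M d \o crv) 0 in
    (v <= tangent_mx c d (coord V c p))%MS ->
    exists (delta : R) (sigma : R -> V),
      [/\ 0 < delta, sigma 0 = p &
          forall t : R, `|t| < delta ->
            {for t, continuous sigma} /\ incl V (sigma t) = crv t].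

(* Indices: e_1 is row ord0, e_n is row ord_max and the e_a (1 < a < n) are
   the rows mid a. *)
Definition mid (n : nat) (a : 'I_n) : 'I_n.+2 := lift ord0 (lift ord_max a).

(* The rows of E u are the components in the chart d of the vectors of a
   first-order isotropic frame at the point with coordinates u in c. *)
Definition isotropic_frame (R : realType) (n : nat) (M : manifold R n.+2)
  (g : lorentz_metric M) (V : hypersurface M) (c : chart V) (d : chart M)
  (W : set 'rV[R]_n.+1) (E : 'rV[R]_n.+1 -> 'M[R]_n.+2) : Prop :=
  [/\ open W, W `<=` local_dom (incl V) c d, smooth_on W E &
   forall u, W u ->
    let s i j := ip (g d (local_expr (incl V) c d u))
                    (row i (E u)) (row j (E u)) in
    [/\ E u \in unitmx /\ (row' ord_max (E u) == tangent_mx c d u)%MS,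
        s ord0 ord0 = 0 /\ (forall a, s ord0 (mid a) = 0),
        forall x : 'rV[R]_n, x != 0 ->
          0 < ip (\matrix_(a, b) s (mid a) (mid b)) x x,
        s ord_max ord_max = 0 /\ s ord0 ord_max = -1 &
        forall a, s (mid a) ord_max = 0]].

(* omega_i^j (X), where D e_i = omega_i^j e_j. *)
Definition conn_form (R : realType) (n : nat) (M : manifold R n.+2)
  (D : affine_connection M) (V : hypersurface M) (c : chart V) (d : chart M)
  (E : 'rV[R]_n.+1 -> 'M[R]_n.+2) (i j : 'I_n.+2) (u X : 'rV[R]_n.+1) : R :=
  (cov D d (local_expr (incl V) c d) X (fun x => row i (E x)) u
     *m invmx (E u)) 0 j.

(* lambda_ab = omega_a^n (e_b), from omega_a^n = lambda_ab omega^b; the factor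
   pinvmx turns e_b, tangent to V, into its components in the chart c. *)
Definition second_fundamental_tensor (R : realType) (n : nat)
  (M : manifold R n.+2) (D : affine_connection M) (V : hypersurface M)
  (c : chart V) (d : chart M) (E : 'rV[R]_n.+1 -> 'M[R]_n.+2)
  (u : 'rV[R]_n.+1) : 'M[R]_n :=
  \matrix_(a, b) conn_form D c d E (mid a) ord_max u
    (row (mid b) (E u) *m pinvmx (tangent_mx c d u)).

(* A direction at incl V p is given by a nonzero vector, up to scaling: only
   the row space of norm_dir d p is meaningful. *)
Record isotropic_normalization (R : realType) (n : nat) (M : manifold R n.+2)
  (g : lorentz_metric M) (V : hypersurface M) := IsotropicNormalization {
  norm_dir :> chart M -> V -> 'rV[R]_n.+2 ;
  norm_neq0 : forall d p, dom M d (incl V p) -> norm_dir d p != 0 ;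
  norm_isotropic : forall d p, dom M d (incl V p) ->
    ip (g d (coord M d (incl V p))) (norm_dir d p) (norm_dir d p) = 0 ;
  norm_transversal : forall c d p, dom V c p -> dom M d (incl V p) ->
    ~~ (norm_dir d p <= tangent_mx c d (coord V c p))%MS ;
  norm_change : forall d d' p,
    dom M d (incl V p) -> dom M d' (incl V p) ->
    (norm_dir d' p ==
       norm_dir d p *m 'J (transition d d') (coord M d (incl V p)))%MS ;
  norm_smooth : forall c d p, dom V c p -> dom M d (incl V p) ->
    exists (W : set 'rV[R]_n.+1) (nu : 'rV[R]_n.+1 -> 'rV[R]_n.+2),
      [/\ open W, W (coord V c p), W `<=` local_dom (incl V) c d,
          smooth_on W nu &
          forall u, W u -> (nu u == norm_dir d (param V c u))%MS] }.

(* For X, Y tangent to V, nabla_X Y is the projection of D_X Y onto the tangent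
   hyperplane along the normalizing direction. *)
Definition induced_connection (R : realType) (n : nat) (M : manifold R n.+2)
  (g : lorentz_metric M) (D : affine_connection M) (V : hypersurface M)
  (N : isotropic_normalization g V) (nabla : affine_connection V) : Prop :=
  forall (c : chart V) (d : chart M) (p : V) (W : set 'rV[R]_n.+1)
    (X : 'rV[R]_n.+1) (Y : 'rV[R]_n.+1 -> 'rV[R]_n.+1),
    dom V c p -> dom M d (incl V p) ->
    open W -> W (coord V c p) -> smooth_on W Y ->
    let u := coord V c p in
    cov nabla c id X Y u *m tangent_mx c d u =
      cov D d (local_expr (incl V) c d) X (fun x => Y x *m tangent_mx c d x) u
        *m proj_mx <<tangent_mx c d u>>%MS <<norm_dir N d p>>%MS.

(* Main.v *)
From HB Require Import structures.
From mathcomp Require Import ring lra.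
Require Import Defs.
Import Order.TTheory GRing.Theory Num.Theory.
Import numFieldNormedType.Exports.
Local Open Scope classical_set_scope.
Local Open Scope ring_scope.

(** Everything follows from one fact: on a totally geodesic hypersurface V the
    ambient derivative D_X Y of tangent vector fields is tangent to V.

    In charts, let F be the local expression of the inclusion and T its
    Jacobian, whose row space is the tangent hyperplane.  For fields with
    constant components v and w, D_v w is
      S(v, w) = d^2F(v, w) + Gamma(dF v, dF w)
    ([ambient_cov]).  Through every point and in every tangent direction v
    there is a geodesic x of M, by Picard's theorem ([ode_exists],
    [geodesic_exists]).  By hypothesis it lifts to a continuous curve s in V
    with F o s = x; as F is an immersion, s is differentiable
    ([lift_derivable]), and differentiating x' = s' T(s) once more shows that
    x'' - d^2F(v, v) is tangent ([immersed_curve_acceleration]).  Since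
    x'' = - Gamma(x', x'), the vector S(v, v) is tangent.  The Levi-Civita
    connection has no torsion and second derivatives commute ([schwarz]), so S
    is symmetric and polarization makes S(v, w) tangent
    ([ambient_cov_tangent]).

    The three conclusions are then formal.
    - The vectors e_a of an isotropic frame are tangent to V, hence so are
      their derivatives along V, and the component of D e_a on e_n is zero.
    - Projecting D_X Y onto the tangent hyperplane along a normalizing
      direction changes nothing, so all normalizations induce the same
      connection, given by S = Gamma^V T.  Its coefficients are smooth because
      T has the smooth right inverse T^t (T T^t)^-1, and they obey the
      transformation law because S is the second derivative of F corrected by
      Gamma, which behaves well under composition of F with changes of
      coordinates on either side ([cov_hess_precomp], [cov_hess_postcomp]).
    - As the induced derivative is the restriction of D ([cov_induced]), so is
      its curvature: the third derivatives of F and the mixed terms in d^2F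
      cancel by symmetry and the ambient curvature remains
      ([curvature_induced]).

    Smoothness is given here by iterated directional derivatives, so the first
    parts recover the usual calculus from it: C^1 functions are
    differentiable, second derivatives are symmetric, and C^k functions are
    stable under products, composition and matrix inversion. *)

(** * Directional derivatives *)

Section Directional.
Context {R : realType} {V : normedModType R}.

Lemma is_derive_line {W : normedModType R} (f : V -> W) (a v : V) (s : R) :
  derivable f (a + s *: v) v ->
  is_derive s 1 (fun t : R => f (a + t *: v)) ('D_v f (a + s *: v)).
Proof.
move=> fv.
have E : (fun h : R => h^-1 *: (((fun t : R => f (a + t *: v)) \o shift s) (h *: 1)
            - f (a + s *: v))) =
         (fun h : R => h^-1 *: ((f \o shift (a + s *: v)) (h *: v) - f (a + s *: v))).
  apply/funext => h /=; rewrite [h *: 1]mulr1 scalerDl.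
  by congr (_ *: (f _ - _)); rewrite addrCA.
by split; rewrite /derivable /derive E.
Qed.

Lemma is_derive_scale_dir {W : normedModType R} (f : V -> W) (a v : V) (c : R) :
  derivable f a v -> is_derive a (c *: v) f (c *: 'D_v f a).
Proof.
move=> fv.
pose g (t : R) := f (a + t *: v).
have gd : is_derive (0 : R) 1 g ('D_v f a).
  have := @is_derive_line _ f a v 0; rewrite scale0r addr0; exact.
have g0 : differentiable g (c *: (0 : R)).
  by rewrite scaler0; apply/derivable1_diffP; case: gd.
have cd : differentiable ( *:%R c : R -> R) (0 : R) by [].
have gc : differentiable (g \o ( *:%R c : R -> R)) (0 : R) by exact: differentiable_comp.
have Dgc : 'D_1 (g \o ( *:%R c : R -> R)) (0 : R) = c *: 'D_v f a.
  rewrite deriveE// diff_comp//= diff_val linearZ/=.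
  by rewrite -deriveE// scaler0 derive_val.
have E : (fun h : R => h^-1 *: (((g \o ( *:%R c : R -> R)) \o shift 0) (h *: 1)
            - (g \o ( *:%R c : R -> R)) 0)) =
         (fun h : R => h^-1 *: ((f \o shift a) (h *: (c *: v)) - f a)).
  apply/funext => h /=; rewrite [h *: 1]mulr1 addr0 /g scaler0 scale0r addr0 /=.
  by rewrite [_ + a]addrC scalerA [h * c]mulrC.
split.
  by have /diff_derivable := gc => /(_ 1); rewrite /derivable E.
by rewrite -Dgc /derive E.
Qed.

(** Derivatives are taken along the full displacement v, so that the mean value
    theorem involves no unit vector and no length. *)
Lemma line_MVT (f : V -> R) (a v : V) :
  (forall s : R, 0 <= s <= 1 -> derivable f (a + s *: v) v) ->
  exists2 s : R, 0 <= s <= 1 & f (a + v) - f a = 'D_v f (a + s *: v).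
Proof.
move=> fv; pose g (t : R) := f (a + t *: v).
have gd (s : R) : 0 <= s <= 1 -> is_derive s 1 g ('D_v f (a + s *: v)).
  by move=> s01; apply: is_derive_line; exact: fv.
have [||s s01] := @MVT_segment _ g (fun s => 'D_v f (a + s *: v)) 0 1 ler01.
- by move=> x /[!in_itv]/= /andP[x0 x1]; apply: gd; rewrite !ltW.
- by apply: derivable_within_continuous => x /[!in_itv]/= /gd[].
rewrite subr0 mulr1 /g scale1r scale0r addr0 => E.
by exists s => //; move: s01; rewrite in_itv.
Qed.

(** Additivity in the direction, before differentiability is known: move first
    along v, then along w by the mean value theorem, and use the continuity of
    the derivative along w at a. *)
Lemma is_derive_add_dir (f : V -> R) (a v w : V) :
  derivable f a v -> (\forall x \near a, derivable f x w) ->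
  {for a, continuous (fun x => 'D_w f x)} ->
  is_derive a (v + w) f ('D_v f a + 'D_w f a).
Proof.
move=> fv fw cw.
suff H : (fun h : R => h^-1 *: ((f \o shift a) (h *: (v + w)) - f a)) @ 0^' -->
    'D_v f a + 'D_w f a.
  by split; [apply/cvg_ex; eexists; exact: H|exact: cvg_lim H].
have E : (fun h : R => h^-1 *: ((f \o shift a) (h *: (v + w)) - f a)) =
   (fun h : R => h^-1 *: ((f \o shift a) (h *: v) - f a)) \+
   (fun h : R => h^-1 *: (f (h *: v + a + h *: w) - f (h *: v + a))).
  apply/funext => h /=; rewrite -scalerDr; congr (_ *: _).
  by rewrite scalerDr addrAC [RHS]addrC subrKA.
rewrite E; apply: cvgD; first exact: fv.
apply/cvgrPdist_le => /= e e0.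
have : \forall x \near a, derivable f x w /\ `|'D_w f a - 'D_w f x| <= e.
  by apply: filterI => //; move/cvgrPdist_le : cw; exact.
move=> /nbhs_ballP[d /= d0 Hd].
have vw0 : 0 < `|v| + `|w| + 1 by rewrite ltr_wpDl// addr_ge0.
near=> h.
have hN0 : h != 0 by near: h; exact: nbhs_dnbhs_neq.
have hd : `|h| * (`|v| + `|w| + 1) < d.
  rewrite -ltr_pdivlMr//; near: h; apply: dnbhs0_lt; exact: divr_gt0.
have Hs (s : R) : 0 <= s <= 1 -> ball a d (h *: v + a + s *: (h *: w)).
  move=> /andP[s0 s1]; rewrite -ball_normE /= distrC.
  rewrite addrAC addrK (le_lt_trans _ hd)// (le_trans (ler_normD _ _))//.
  rewrite !normrZ (ger0_norm s0) !mulrDr mulr1 -addrA lerD2l.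
  rewrite ler_wpDr// ler_piMl// mulr_ge0//.
have [s s01 Es] := @line_MVT f (h *: v + a) (h *: w) (fun s s01 =>
  @ex_derive _ _ _ _ _ _ _ (is_derive_scale_dir h (Hd _ (Hs s s01)).1)).
rewrite Es.
have [dh _] := Hd _ (Hs s s01).
rewrite (@derive_val _ _ _ _ _ _ _ (is_derive_scale_dir h dh)) scalerK//.
by have [] := Hd _ (Hs s s01).
Unshelve. all: by end_near. Qed.

End Directional.

(** * Functions of class C^k *)

Section MxNorm.
Context {R : realType} {p q : nat}.
Implicit Types M : 'M[R]_(p, q).

Lemma ler_norm_entry M i j : `|M i j| <= `|M|.
Proof.
rewrite [leRHS]/Num.Def.normr/= mx_normrE.
exact: (le_bigmax _ (fun ij => `|M ij.1 ij.2|) (i, j)).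
Qed.

Lemma mx_norm_le M (e : R) : 0 <= e -> (forall i j, `|M i j| <= e) -> `|M| <= e.
Proof.
move=> e0 Me; rewrite [leLHS]/Num.Def.normr/= mx_normrE.
by apply: bigmax_le => // ij _; exact: Me.
Qed.

Lemma continuous_mxP {T : topologicalType} (f : T -> 'M[R]_(p, q)) (x : T) :
  {for x, continuous f} <-> forall i j, {for x, continuous (fun y => f y i j)}.
Proof.
split=> [fc i j|fc].
  exact: (@continuous_comp _ _ _ f (fun M : 'M[R]_(p, q) => M i j) x fc
    (@matrix_normedtype.coord_continuous _ _ _ i j _)).
apply/cvgrPdist_le => /= e e0.
have : \forall y \near x, forall i j, `|f x i j - f y i j| <= e.
  apply: filter_forall => i; apply: filter_forall => j.
  by have /cvgrPdist_le := fc i j; exact.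
apply: filterS => y fy; apply: mx_norm_le => [|i j]; first exact: ltW.
by rewrite !mxE; exact: fy.
Qed.

Lemma differentiable_mx {V : normedModType R} (f : V -> 'M[R]_(p, q)) (x : V) :
  (forall i j, differentiable (fun y => f y i j) x) -> differentiable f x.
Proof.
move=> fd.
have -> : f = \sum_(i < p) \sum_(j < q) (fun y => f y i j *: delta_mx i j).
  apply/funext => y; rewrite fct_sumE {1}[f y]matrix_sum_delta.
  by apply: eq_bigr => i _; rewrite fct_sumE.
apply: differentiable_sum => i; apply: differentiable_sum => j.
exact: differentiableZl.
Qed.

End MxNorm.

(** The differential is defined by choice among the linear maps with a little-o
    expansion; any linear map with explicit bounds of this kind qualifies. *)
Lemma differentiable_expansion {R : realType} {V W : normedModType R}
    (f : V -> W) (df : {linear V -> W}) (a : V) :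
  continuous df ->
  (forall e : R, 0 < e ->
    \forall h \near 0, `|f (a + h) - f a - df h| <= e * `|h|) ->
  differentiable f a.
Proof.
move=> dfc fe.
have E : f \o shift a = cst (f a) + df +o_ 0 id.
  apply/eqaddoP => e e0; apply: filterS (fe e e0) => h.
  rewrite -![(_ + _ : _ -> _) _]/(_ + _) -![(- _ : _ -> _) _]/(- _) /=.
  by rewrite [h + a]addrC opprD addrA.
by apply/diff_locallyP; rewrite (diff_unique dfc E).
Qed.

Lemma near_open {T : topologicalType} (U : set T) (x : T) (P : T -> Prop) :
  open U -> U x -> (forall y, U y -> P y) -> \forall y \near x, P y.
Proof. by move=> oU Ux UP; exact: filterS UP (open_nbhs_nbhs (conj oU Ux)). Qed.

Lemma near_eq_continuous {T S : topologicalType} (f g : T -> S) (x : T) :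
  {near x, f =1 g} -> {for x, continuous f} -> {for x, continuous g}.
Proof.
move=> fg fc; rewrite /prop_for /continuous_at -(nbhs_singleton fg).
by apply: cvg_trans fc; apply: near_eq_cvg; apply: filterS fg => y ->.
Qed.

Section Ck.
Context {R : realType} {m : nat}.
Implicit Types (U : set 'rV[R]_m) (k : nat).

Lemma Ck_on_continuous {W : normedModType R} k U (f : 'rV[R]_m -> W) u :
  Ck_on k U f -> U u -> {for u, continuous f}.
Proof. by case: k => [|k] [fc _] /fc. Qed.

Lemma Ck_on_derivable {W : normedModType R} k U (f : 'rV[R]_m -> W) u v :
  Ck_on k.+1 U f -> U u -> derivable f u v.
Proof. by move=> [_ /(_ v)[fd _]] /fd. Qed.

Lemma Ck_on_derive {W : normedModType R} k U (f : 'rV[R]_m -> W) v :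
  Ck_on k.+1 U f -> Ck_on k U (fun u => 'D_v f u).
Proof. by move=> [_ /(_ v)[]]. Qed.

Lemma Ck_onS {W : normedModType R} k U (f : 'rV[R]_m -> W) :
  (forall u, U u -> {for u, continuous f}) ->
  (forall v u, U u -> derivable f u v) ->
  (forall v, Ck_on k U (fun u => 'D_v f u)) ->
  Ck_on k.+1 U f.
Proof. by move=> fc fd Df; split=> // v; split=> [u|]; [exact: fd|exact: Df]. Qed.

Lemma Ck_on_le {W : normedModType R} k U (f : 'rV[R]_m -> W) :
  Ck_on k.+1 U f -> Ck_on k U f.
Proof.
elim: k f => [|k IH] f fk; first by split=> //; case: fk.
apply: Ck_onS => [u||v]; first exact: Ck_on_continuous fk.
- by move=> v u; exact: Ck_on_derivable fk.
- exact/IH/Ck_on_derive.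
Qed.

Lemma eq_Ck_on {W : normedModType R} k U (f g : 'rV[R]_m -> W) :
  open U -> (forall u, U u -> f u = g u) -> Ck_on k U f -> Ck_on k U g.
Proof.
move=> oU; elim: k f g => [|k IH] f g fg fk.
  have fgn u : U u -> {near u, f =1 g} by move=> Uu; exact: near_open oU Uu fg.
  split=> // u Uu; have fc := Ck_on_continuous fk Uu.
  exact: near_eq_continuous (fgn _ Uu) fc.
have fgn u : U u -> {near u, f =1 g} by move=> Uu; exact: near_open oU Uu fg.
apply: Ck_onS => [u Uu|v u Uu|v].
- have fc := Ck_on_continuous fk Uu.
  exact: near_eq_continuous (fgn _ Uu) fc.
- by apply: near_eq_derivable (fgn _ Uu) _; exact: Ck_on_derivable fk Uu.
- apply: IH (Ck_on_derive v fk) => u Uu.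
  exact/near_eq_derive/fgn.
Qed.

Lemma Ck_on_mxP {p q} k U (f : 'rV[R]_m -> 'M[R]_(p, q)) : open U ->
  Ck_on k U f <-> forall i j, Ck_on k U (fun u => f u i j).
Proof.
move=> oU; elim: k f => [|k IH] f.
  split=> [[fc _] i j|fc]; split=> // u Uu.
    by move: i j; apply/continuous_mxP; exact: fc.
  by apply/continuous_mxP => i j; have [/(_ u Uu)] := fc i j.
split=> [fk i j|fk].
  apply: Ck_onS => [u Uu|v u Uu|v].
  - by move: i j; apply/continuous_mxP; exact: Ck_on_continuous fk Uu.
  - by move: i j; apply/derivable_mxP; exact: Ck_on_derivable fk Uu.
  - apply: eq_Ck_on oU _ ((IH _).1 (Ck_on_derive v fk) i j) => u Uu /=.
    by rewrite derive_mx ?mxE//; exact: Ck_on_derivable fk Uu.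
have fd v u : U u -> derivable f u v.
  by move=> Uu; apply/derivable_mxP => i j; exact: Ck_on_derivable (fk i j) Uu.
apply: Ck_onS => [u Uu|//|v].
- by apply/continuous_mxP => i j; exact: Ck_on_continuous (fk i j) Uu.
- apply/IH => i j; apply: eq_Ck_on oU _ (Ck_on_derive v (fk i j)) => u Uu /=.
  by rewrite derive_mx ?mxE//; exact: fd.
Qed.

Lemma Ck_on_sub {W : normedModType R} k U U' (f : 'rV[R]_m -> W) :
  U' `<=` U -> Ck_on k U f -> Ck_on k U' f.
Proof.
move=> UU; elim: k f => [|k IH] f; first by move=> [fc _]; split=> // u /UU/fc.
move=> fk; apply: Ck_onS => [u /UU|v u /UU|v].
- exact: Ck_on_continuous fk.
- exact: Ck_on_derivable fk.
- exact/IH/Ck_on_derive.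
Qed.

(** Membership in C^k is local because every clause of the definition is
    pointwise. *)
Lemma Ck_on_local {W : normedModType R} k U (f : 'rV[R]_m -> W) :
  (forall u, U u -> exists2 U', U' u & Ck_on k U' f) -> Ck_on k U f.
Proof.
elim: k f => [|k IH] f fk.
  by split=> // u /fk[U' U'u [/(_ u U'u)]].
apply: Ck_onS => [u /fk[U' U'u fU']|v u /fk[U' U'u fU']|v].
- exact: Ck_on_continuous fU' U'u.
- exact: Ck_on_derivable fU' U'u.
- apply: IH => u /fk[U' U'u fU']; exists U' => //.
  exact: Ck_on_derive.
Qed.

(** The direction is a combination of basis vectors, so additivity and
    homogeneity in the direction express every directional derivative by the
    partial ones. *)
Lemma C1_is_derive U (f : 'rV[R]_m -> R) u (v : 'rV[R]_m) : open U -> U u -> Ck_on 1 U f ->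
  is_derive u v f (\sum_i v 0 i * 'D_(delta_mx 0 i) f u).
Proof.
move=> oU Uu f1; rewrite [X in is_derive _ X](row_sum_delta v).
elim: (index_enum _) => [|i r IH]; first by rewrite !big_nil; exact: is_derive0.
have fi := is_derive_scale_dir (v 0 i) (Ck_on_derivable (v := delta_mx 0 i) f1 Uu).
rewrite !big_cons addrC [X in is_derive _ _ _ X]addrC.
have dfi : 'D_(v 0 i *: delta_mx 0 i) f u = v 0 i * 'D_(delta_mx 0 i) f u.
  by case: fi.
have dIH : 'D_(\sum_(j <- r) v 0 j *: delta_mx 0 j) f u =
    \sum_(j <- r) v 0 j * 'D_(delta_mx 0 j) f u by case: IH.
rewrite -dfi -dIH.
apply: is_derive_add_dir.
- by case: IH.
- by apply: near_open oU Uu _ => x; exact: Ck_on_derivable f1.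
- exact: Ck_on_continuous (Ck_on_derive (v 0 i *: delta_mx 0 i) f1) Uu.
Qed.

(** The difference between f (a + h) - f a and the candidate linear map is, by
    the mean value theorem on the segment, a combination with coefficients
    h 0 i of increments of partial derivatives, which are small by continuity. *)
Lemma C1_differentiable U (f : 'rV[R]_m -> R) a : open U -> U a -> Ck_on 1 U f ->
  differentiable f a.
Proof.
move=> oU Ua f1.
pose df (v : 'rV[R]_m) : R := \sum_i v 0 i * 'D_(delta_mx 0 i) f a.
have dflin : linear df.
  move=> c v w; rewrite /df scaler_sumr -big_split/=; apply: eq_bigr => i _.
  by rewrite !mxE mulrDl -mulrA.
pose dfM := GRing.isLinear.Build _ _ _ _ _ dflin.
pose dfL : {linear _ -> _} := HB.pack df dfM.
have dfc : continuous dfL.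
  move=> v.
  have -> : (dfL : _ -> _) =
      \sum_(i < m) (fun v : 'rV[R]_m => v 0 i *: 'D_(delta_mx 0 i) f a).
    by apply/funext => w; rewrite fct_sumE.
  apply: differentiable_continuous; apply: differentiable_sum => i.
  by apply: differentiableZl; exact: differentiable_coord.
apply: (@differentiable_expansion _ _ _ f dfL) => // e e0.
(* The successor keeps the denominator positive when m = 0. *)
pose e' := e / m.+1%:R.
have e'0 : 0 < e' by rewrite divr_gt0.
have Di (i : 'I_m) : \forall x \near a,
    `|'D_(delta_mx 0 i) f a - 'D_(delta_mx 0 i) f x| <= e'.
  by have /cvgrPdist_le := Ck_on_continuous (Ck_on_derive (delta_mx 0 i) f1) Ua; exact.
have Dn := filter_forall (nbhs_filter a) Di.
have := @filterI _ _ (nbhs_filter a) _ _ (open_nbhs_nbhs (conj oU Ua)) Dn.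
move=> /nbhs_ballP[d /= d0 Hd].
have H0 : \forall h \near (0 : 'rV[R]_m), `|h| < d := nbhs0_lt d0.
apply: (@filterS _ _ (nbhs_filter _) _ _ _ H0) => h hd.
have Hs (s : R) : 0 <= s <= 1 -> ball a d (a + s *: h).
  move=> /andP[s0 s1]; rewrite -ball_normE /= opprD addNKr normrN normrZ ger0_norm//.
  by rewrite (le_lt_trans (ler_piMl _ s1)).
have [s s01 Es] := @line_MVT R _ f a h (fun s s01 =>
  Ck_on_derivable (v := h) f1 (Hd _ (Hs s s01)).1).
have [Us Ds] := Hd _ (Hs _ s01).
rewrite Es (derive_val (is_derive := C1_is_derive h oU Us f1)) /df -sumrB.
rewrite (le_trans (ler_norm_sum _ _ _))//.
rewrite (@le_trans _ _ (\sum_(i < m) (`|h| * e')))//.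
  apply: ler_sum => i _; rewrite -mulrBr normrM ler_pM ?ler_norm_entry// distrC.
  exact: Ds.
rewrite sumr_const card_ord -mulr_natr -mulrA mulrC ler_wpM2r// /e' -mulrA.
by rewrite ler_piMr ?(ltW e0)// mulrC ler_pdivrMr// mul1r ler_nat.
Qed.

End Ck.

Section Calculus.
Context {R : realType} {m : nat}.
Implicit Types (U : set 'rV[R]_m) (k : nat).

Lemma Ck_on_C1 {W : normedModType R} k U (f : 'rV[R]_m -> W) :
  Ck_on k.+1 U f -> Ck_on 1 U f.
Proof. by elim: k => // k IH /Ck_on_le. Qed.

Lemma Ck_on_differentiable {p q} U (f : 'rV[R]_m -> 'M[R]_(p, q)) k a :
  open U -> Ck_on k.+1 U f -> U a -> differentiable f a.
Proof.
move=> oU fk Ua; apply: differentiable_mx => i j; apply: (C1_differentiable oU Ua).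
by apply: (Ck_on_mxP 1 f oU).1; exact: Ck_on_C1 fk.
Qed.

Lemma derive_comp {V W Z : normedModType R} (f : V -> W) (g : W -> Z) (a v : V) :
  differentiable f a -> differentiable g (f a) ->
  'D_v (g \o f) a = 'D_('D_v f a) g (f a).
Proof.
move=> fd gd; rewrite !deriveE//; last exact: differentiable_comp.
by rewrite diff_comp.
Qed.

Lemma Ck_on_cst {W : normedModType R} k U (c : W) : Ck_on k U (fun=> c).
Proof.
elim: k c => [|k IH] c; first by split=> // u _; exact: cst_continuous.
apply: Ck_onS => [u _|v u _|v]; [exact: cst_continuous|exact: derivable_cst|].
by under [fun u => _]eq_fun do rewrite derive_cst; exact: IH.
Qed.

Lemma Ck_onD {W : normedModType R} k U (f g : 'rV[R]_m -> W) : open U ->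
  Ck_on k U f -> Ck_on k U g -> Ck_on k U (fun u => f u + g u).
Proof.
move=> oU; elim: k f g => [|k IH] f g fk gk.
  by split=> // u Uu; apply: continuousD;
    [exact: (Ck_on_continuous fk Uu)|exact: (Ck_on_continuous gk Uu)].
apply: Ck_onS => [u Uu|v u Uu|v].
- by apply: continuousD;
    [exact: (Ck_on_continuous fk Uu)|exact: (Ck_on_continuous gk Uu)].
- by apply: derivableD; [exact: Ck_on_derivable fk Uu|exact: Ck_on_derivable gk Uu].
- apply: eq_Ck_on oU _ (IH _ _ (Ck_on_derive v fk) (Ck_on_derive v gk)) => u Uu.
  by rewrite deriveD//; [exact: Ck_on_derivable fk Uu|exact: Ck_on_derivable gk Uu].
Qed.

Lemma Ck_onM k U (f g : 'rV[R]_m -> R) : open U ->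
  Ck_on k U f -> Ck_on k U g -> Ck_on k U (fun u => f u * g u).
Proof.
move=> oU; elim: k f g => [|k IH] f g fk gk.
  by split=> // u Uu; apply: continuousM;
    [exact: (Ck_on_continuous fk Uu)|exact: (Ck_on_continuous gk Uu)].
apply: Ck_onS => [u Uu|v u Uu|v].
- by apply: continuousM;
    [exact: (Ck_on_continuous fk Uu)|exact: (Ck_on_continuous gk Uu)].
- by apply: derivableM; [exact: Ck_on_derivable fk Uu|exact: Ck_on_derivable gk Uu].
- apply: eq_Ck_on oU _ (Ck_onD oU
    (IH _ _ (Ck_on_le fk) (Ck_on_derive v gk)) (IH _ _ (Ck_on_le gk) (Ck_on_derive v fk))) => u Uu.
  by rewrite deriveM//; [exact: Ck_on_derivable fk Uu|exact: Ck_on_derivable gk Uu].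
Qed.

Lemma Ck_on_sum {W : normedModType R} {I : Type} (r : seq I) (P : pred I) k U
    (f : I -> 'rV[R]_m -> W) : open U ->
  (forall i, P i -> Ck_on k U (f i)) -> Ck_on k U (fun u => \sum_(i <- r | P i) f i u).
Proof.
move=> oU fk; elim: r => [|i r IH].
  by under eq_fun do rewrite big_nil; exact: Ck_on_cst.
case: (boolP (P i)) => [Pi|/negbTE Pi]; under eq_fun do rewrite big_cons Pi; last exact: IH.
by apply: Ck_onD => //; exact: fk.
Qed.

Lemma Ck_on_prod {I : Type} (r : seq I) (P : pred I) k U
    (f : I -> 'rV[R]_m -> R) : open U ->
  (forall i, P i -> Ck_on k U (f i)) -> Ck_on k U (fun u => \prod_(i <- r | P i) f i u).
Proof.
move=> oU fk; elim: r => [|i r IH].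
  by under eq_fun do rewrite big_nil; exact: Ck_on_cst.
case: (boolP (P i)) => [Pi|/negbTE Pi]; under eq_fun do rewrite big_cons Pi; last exact: IH.
by apply: Ck_onM => //; exact: fk.
Qed.

Lemma Ck_onV k U (f : 'rV[R]_m -> R) : open U ->
  (forall u, U u -> f u != 0) -> Ck_on k U f -> Ck_on k U (fun u => (f u)^-1).
Proof.
move=> oU f0; elim: k => [|k IH] fk.
  by split=> // u Uu; apply: continuousV; [exact: f0|exact: (Ck_on_continuous fk Uu)].
apply: Ck_onS => [u Uu|v u Uu|v].
- by apply: continuousV; [exact: f0|exact: (Ck_on_continuous fk Uu)].
- by apply: derivableV; [exact: f0|exact: Ck_on_derivable fk Uu].
- have fV := IH (Ck_on_le fk).
  have f1 : Ck_on k U (fun=> -1 : R) by exact: Ck_on_cst.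
  have f2 := Ck_onM oU (Ck_onM oU f1 (Ck_onM oU fV fV)) (Ck_on_derive v fk).
  apply: eq_Ck_on oU _ f2 => u Uu.
  rewrite deriveV; [|exact: f0|exact: Ck_on_derivable fk Uu].
  by rewrite mulN1r -expr2 exprVn.
Qed.

End Calculus.

Section Composition.
Context {R : realType} {m : nat}.
Implicit Types (U : set 'rV[R]_m) (k : nat).

(** By the chain rule the derivative of h o f along v is the sum over i of
    (D_v f)_i (d_i h) o f; the functions d_i h are of class C^k, so the
    induction hypothesis must be available for every h. *)
Lemma Ck_on_comp {q} k U (U' : set 'rV[R]_q) (h : 'rV[R]_q -> R) (f : 'rV[R]_m -> 'rV[R]_q) :
  open U -> open U' -> (forall u, U u -> U' (f u)) ->
  Ck_on k U' h -> Ck_on k U f -> Ck_on k U (h \o f).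
Proof.
move=> oU oU' fU; elim: k h => [|k IH] h hk fk.
  split=> // u Uu; apply: continuous_comp; first exact: (Ck_on_continuous fk Uu).
  exact: (Ck_on_continuous hk (fU _ Uu)).
have hd u : U u -> differentiable h (f u).
  move=> Uu; apply: (C1_differentiable oU' (fU _ Uu)); exact: Ck_on_C1 hk.
have fd u : U u -> differentiable f u by move=> Uu; exact: Ck_on_differentiable oU fk Uu.
apply: Ck_onS => [u Uu|v u Uu|v].
- apply: continuous_comp; first exact: (Ck_on_continuous fk Uu).
  exact: (Ck_on_continuous hk (fU _ Uu)).
- by apply: diff_derivable; apply: differentiable_comp; [exact: fd|exact: hd].
- have H (i : 'I_q) : Ck_on k U (fun u => ('D_v f u) 0 i * 'D_(delta_mx 0 i) h (f u)).
    apply: Ck_onM => //.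
      by apply: (Ck_on_mxP k _ oU).1; exact: Ck_on_derive.
    exact: IH (Ck_on_derive (delta_mx 0 i) hk) (Ck_on_le fk).
  have Hs := Ck_on_sum (index_enum _) (P := xpredT) oU (fun i _ => H i).
  apply: eq_Ck_on oU _ Hs => u Uu.
  rewrite (derive_comp v (fd u Uu) (hd u Uu)).
  by rewrite (derive_val (is_derive := C1_is_derive _ oU' (fU _ Uu) (Ck_on_C1 hk))).
Qed.

End Composition.

(** * Matrix-valued smooth functions *)

Section MatrixDerivative.
Context {R : realType} {V : normedModType R}.

Lemma is_derive_mulmx {p q r} (A : V -> 'M[R]_(p, q)) (B : V -> 'M[R]_(q, r)) (a v : V) :
  derivable A a v -> derivable B a v ->
  is_derive a v (fun x => A x *m B x) ('D_v A a *m B a + A a *m 'D_v B a).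
Proof.
move=> dA dB.
have dAe i j : derivable (fun x => A x i j) a v by move: i j; apply/derivable_mxP.
have dBe i j : derivable (fun x => B x i j) a v by move: i j; apply/derivable_mxP.
have E i j : (fun x => (A x *m B x) i j) =
    \sum_(k < q) ((fun x => A x i k) * (fun x => B x k j)).
  by apply/funext => x; rewrite fct_sumE mxE.
have dE i j : derivable (fun x => (A x *m B x) i j) a v.
  by rewrite E; apply: derivable_sum => k; exact: derivableM.
have d : derivable (fun x => A x *m B x) a v by apply/derivable_mxP.
split=> //; rewrite derive_mx//; apply/matrixP => i j; rewrite mxE E.
rewrite derive_sum => [|k]; last exact: derivableM.
rewrite !mxE -big_split /=; apply: eq_bigr => k _.
rewrite deriveM// derive_mx// [in RHS]derive_mx// !mxE addrC.
by congr (_ + _); rewrite [LHS]mulrC.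
Qed.

Lemma derive_mulmx {p q r} (A : V -> 'M[R]_(p, q)) (B : V -> 'M[R]_(q, r)) (a v : V) :
  derivable A a v -> derivable B a v ->
  'D_v (fun x => A x *m B x) a = 'D_v A a *m B a + A a *m 'D_v B a.
Proof. by move=> dA dB; apply: derive_val; exact: is_derive_mulmx. Qed.

Lemma is_derive_mulmxl {p q r} (A : 'M[R]_(p, q)) (B : V -> 'M[R]_(q, r)) (a v : V) :
  derivable B a v -> is_derive a v (fun x => A *m B x) (A *m 'D_v B a).
Proof.
move=> dB; have := @is_derive_mulmx _ _ _ (cst A) B a v (derivable_cst _ _ _) dB.
by rewrite derive_cst mul0mx add0r.
Qed.

Lemma is_derive_mulmxr {p q r} (A : V -> 'M[R]_(p, q)) (B : 'M[R]_(q, r)) (a v : V) :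
  derivable A a v -> is_derive a v (fun x => A x *m B) ('D_v A a *m B).
Proof.
move=> dA; have := @is_derive_mulmx _ _ _ A (cst B) a v dA (derivable_cst _ _ _).
by rewrite derive_cst mulmx0 addr0.
Qed.

End MatrixDerivative.

Section Smooth.
Context {R : realType} {m : nat}.
Implicit Types U : set 'rV[R]_m.

Lemma smooth_on_mxP {p q} U (f : 'rV[R]_m -> 'M[R]_(p, q)) : open U ->
  smooth_on U f <-> forall i j, smooth_on U (fun u => f u i j).
Proof.
move=> oU; split=> [fs i j k|fs k].
  by apply: (Ck_on_mxP k f oU).1; exact: fs.
by apply/(Ck_on_mxP k f oU) => i j; exact: fs.
Qed.

Lemma smooth_on_sub {W : normedModType R} U U' (f : 'rV[R]_m -> W) :
  U' `<=` U -> smooth_on U f -> smooth_on U' f.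
Proof. by move=> UU fs k; exact: Ck_on_sub UU (fs k). Qed.

Lemma eq_smooth_on {W : normedModType R} U (f g : 'rV[R]_m -> W) : open U ->
  (forall u, U u -> f u = g u) -> smooth_on U f -> smooth_on U g.
Proof. by move=> oU fg fs k; exact: eq_Ck_on oU fg (fs k). Qed.

Lemma smooth_on_local {W : normedModType R} U (f : 'rV[R]_m -> W) :
  (forall u, U u -> exists2 U', U' u & smooth_on U' f) -> smooth_on U f.
Proof.
by move=> fs k; apply: Ck_on_local => u /fs[U' U'u fU']; exists U' => //; exact: fU'.
Qed.

Lemma smooth_on_derive {W : normedModType R} U (f : 'rV[R]_m -> W) v :
  smooth_on U f -> smooth_on U (fun u => 'D_v f u).
Proof. by move=> fs k; exact: Ck_on_derive (fs k.+1). Qed.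

Lemma smooth_on_derivable {W : normedModType R} U (f : 'rV[R]_m -> W) u v :
  smooth_on U f -> U u -> derivable f u v.
Proof. by move=> fs; exact: Ck_on_derivable (fs 1%N). Qed.

Lemma smooth_on_continuous {W : normedModType R} U (f : 'rV[R]_m -> W) u :
  smooth_on U f -> U u -> {for u, continuous f}.
Proof. by move=> fs; exact: Ck_on_continuous (fs 0%N). Qed.

Lemma smooth_on_differentiable {p q} U (f : 'rV[R]_m -> 'M[R]_(p, q)) u :
  open U -> smooth_on U f -> U u -> differentiable f u.
Proof. by move=> oU fs; exact: Ck_on_differentiable oU (fs 1%N). Qed.

Lemma smooth_on_cst {W : normedModType R} U (c : W) : smooth_on U (fun=> c).
Proof. by move=> k; exact: Ck_on_cst. Qed.

Lemma smooth_onD {W : normedModType R} U (f g : 'rV[R]_m -> W) : open U ->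
  smooth_on U f -> smooth_on U g -> smooth_on U (fun u => f u + g u).
Proof. by move=> oU fs gs k; exact: Ck_onD oU (fs k) (gs k). Qed.

Lemma smooth_on_mulmx {p q r} U (A : 'rV[R]_m -> 'M[R]_(p, q))
    (B : 'rV[R]_m -> 'M[R]_(q, r)) : open U ->
  smooth_on U A -> smooth_on U B -> smooth_on U (fun u => A u *m B u).
Proof.
move=> oU As Bs; apply/(smooth_on_mxP _ oU) => i j k.
under eq_fun do rewrite mxE.
apply: Ck_on_sum => // l _; apply: Ck_onM => //.
  exact: (smooth_on_mxP _ oU).1.
exact: (smooth_on_mxP _ oU).1.
Qed.

Lemma smooth_on_trmx {p q} U (A : 'rV[R]_m -> 'M[R]_(p, q)) : open U ->
  smooth_on U A -> smooth_on U (fun u => (A u)^T).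
Proof.
move=> oU As; apply/(smooth_on_mxP _ oU) => i j.
by under eq_fun do rewrite mxE; exact: (smooth_on_mxP _ oU).1.
Qed.

Lemma smooth_on_coord U (j : 'I_m) : smooth_on U (fun u : 'rV[R]_m => u 0 j).
Proof.
case=> [|k]; first by split=> // u _; exact: matrix_normedtype.coord_continuous.
have D (v u : 'rV[R]_m) : is_derive u v (fun u : 'rV[R]_m => u 0 j) (v 0 j).
  split.
    by apply: (derivable_mxP id u v).1; exact: derivable_id.
  have := derive_mx (@derivable_id _ _ u v); rewrite derive_id => /matrixP/(_ 0 j).
  by rewrite mxE => <-.
apply: Ck_onS => [u _|v u _|v]; first exact: matrix_normedtype.coord_continuous.
- by case: (D v u).
- by under eq_fun do rewrite (derive_val (is_derive := D _ _)); exact: Ck_on_cst.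
Qed.

Lemma smooth_on_id U : open U -> smooth_on U id.
Proof.
move=> oU; apply/(smooth_on_mxP _ oU) => i j; rewrite ord1.
exact: smooth_on_coord.
Qed.

Lemma smooth_on_det {p} U (A : 'rV[R]_m -> 'M[R]_p) : open U ->
  smooth_on U A -> smooth_on U (fun u => \det (A u)).
Proof.
move=> oU As k; rewrite /determinant; apply: Ck_on_sum => // s _.
apply: Ck_onM => //; first exact: Ck_on_cst.
by apply: Ck_on_prod => // i _; exact: (smooth_on_mxP _ oU).1.
Qed.

(** Cramer's formula: the entries of the inverse are polynomials in those of A
    divided by the determinant. *)
Lemma smooth_on_invmx {p} U (A : 'rV[R]_m -> 'M[R]_p) : open U ->
  (forall u, U u -> A u \in unitmx) ->
  smooth_on U A -> smooth_on U (fun u => invmx (A u)).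
Proof.
move=> oU Au As.
apply: (@eq_smooth_on _ U (fun u => (\det (A u))^-1 *: \adj (A u))) => //.
  by move=> u /Au uA; rewrite /invmx uA.
apply/(smooth_on_mxP _ oU) => i j.
under eq_fun do rewrite !mxE.
have det0 u : U u -> \det (A u) != 0.
  by move=> /Au; rewrite unitmxE unitfE.
move=> k; apply: Ck_onM => //; first by apply: Ck_onV => //; exact: smooth_on_det.
rewrite /cofactor; apply: Ck_onM => //; first exact: Ck_on_cst.
apply: smooth_on_det => //; apply/(smooth_on_mxP _ oU) => i' j'.
by under eq_fun do rewrite !mxE; exact: (smooth_on_mxP _ oU).1.
Qed.

Lemma smooth_on_jacobian {q} U (f : 'rV[R]_m -> 'rV[R]_q) : open U ->
  smooth_on U f -> smooth_on U (fun u => 'J f u).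
Proof.
move=> oU fs; apply/(smooth_on_mxP _ oU) => i j.
apply: (eq_smooth_on oU _ (f := fun u => ('D_(delta_mx 0 i) f u) 0 j)).
  move=> u Uu; rewrite deriveEjacobian; last exact: smooth_on_differentiable oU fs Uu.
  by rewrite -rowE mxE.
by apply: (smooth_on_mxP _ oU).1; exact: smooth_on_derive.
Qed.

End Smooth.

Section SmoothComposition.
Context {R : realType} {m q : nat}.

Lemma smooth_on_comp {r s} (U : set 'rV[R]_m) (U' : set 'rV[R]_q)
    (h : 'rV[R]_q -> 'M[R]_(r, s)) (f : 'rV[R]_m -> 'rV[R]_q) :
  open U -> open U' -> (forall u, U u -> U' (f u)) ->
  smooth_on U' h -> smooth_on U f -> smooth_on U (h \o f).
Proof.
move=> oU oU' fU hs fs; apply/(smooth_on_mxP _ oU) => i j k.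
apply: (@Ck_on_comp _ _ _ k U U' (fun x => h x i j)) => //.
exact: (smooth_on_mxP _ oU').1.
Qed.

Lemma jacobian_comp {r} (h : 'rV[R]_q -> 'rV[R]_r) (f : 'rV[R]_m -> 'rV[R]_q) (u : 'rV[R]_m) :
  differentiable f u -> differentiable h (f u) ->
  'J (h \o f) u = 'J f u *m 'J h (f u).
Proof.
move=> df dh; apply/row_matrixP => i; rewrite row_mul !rowE.
rewrite -deriveEjacobian; last exact: differentiable_comp.
by rewrite derive_comp// !deriveEjacobian.
Qed.

Lemma near_eq_jacobian (f g : 'rV[R]_m -> 'rV[R]_q) (u : 'rV[R]_m) :
  {near u, f =1 g} -> differentiable f u -> differentiable g u -> 'J f u = 'J g u.
Proof.
move=> fg fd gd; apply/row_matrixP => i; rewrite [LHS]rowE [RHS]rowE.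
apply: etrans (esym (deriveEjacobian (delta_mx 0 i) fd)) _.
apply: etrans (near_eq_derive (delta_mx 0 i) fg) _.
exact: deriveEjacobian.
Qed.

End SmoothComposition.

Lemma jacobian_id {R : realType} {m} (u : 'rV[R]_m) : 'J id u = 1%:M.
Proof.
apply/row_matrixP => i; rewrite !rowE mulmx1.
by rewrite -deriveEjacobian ?derive_id.
Qed.

(** * Symmetry of second derivatives *)

Section Balls.
Context {R : realType} {V : normedModType R}.

Lemma near_ball (a : V) (P : V -> Prop) : (\forall x \near a, P x) ->
  exists2 d : R, 0 < d & forall x, `|x - a| < d -> P x.
Proof.
move=> /nbhs_ballP[d /= d0 Pd]; exists d => // x xa; apply: Pd.
by rewrite -ball_normE /= distrC.
Qed.

Lemma continuous_ball {W : normedModType R} (f : V -> W) (a : V) (e : R) :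
  {for a, continuous f} -> 0 < e ->
  exists2 d : R, 0 < d & forall x, `|x - a| < d -> `|f x - f a| <= e.
Proof.
move=> /cvgrPdist_le fc e0; have [d d0 fd] := near_ball (fc e e0).
by exists d => // x /fd; rewrite distrC.
Qed.

Lemma continuous_of_ball {W : normedModType R} (f : V -> W) (a : V) :
  (forall e : R, 0 < e ->
    exists2 d : R, 0 < d & forall x, `|x - a| < d -> `|f x - f a| <= e) ->
  {for a, continuous f}.
Proof.
move=> fe; apply/cvgrPdist_le => e e0; have [d d0 fd] := fe e e0.
apply/nbhs_ballP; exists d => // x; rewrite -ball_normE /= distrC => /fd.
by rewrite distrC.
Qed.

Lemma open_ball (U : set V) (a : V) : open U -> U a ->
  exists2 d : R, 0 < d & forall x, `|x - a| < d -> U x.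
Proof. by move=> oU Ua; apply: near_ball; exact: near_open oU Ua _. Qed.

End Balls.

Section Schwarz.
Context {R : realType} {m : nat}.
Implicit Types U : set 'rV[R]_m.

Lemma is_derive_translate {V W : normedModType R} (f : V -> W) (a v w : V) :
  derivable f (a + w) v -> is_derive a v (fun x => f (x + w)) ('D_v f (a + w)).
Proof.
move=> fd.
have E : (fun h : R => h^-1 *: (((fun x => f (x + w)) \o shift a) (h *: v) - f (a + w))) =
         (fun h : R => h^-1 *: ((f \o shift (a + w)) (h *: v) - f (a + w))).
  by apply/funext => h /=; rewrite addrA.
by split; rewrite /derivable /derive E.
Qed.

(** The mean value theorem applied twice, to the increment of f along w and
    then to D_v f, evaluates the mixed difference at one intermediate point. *)
Lemma second_difference U (f : 'rV[R]_m -> R) (a v w : 'rV[R]_m) :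
  Ck_on 2 U f ->
  (forall s r : R, 0 <= s <= 1 -> 0 <= r <= 1 -> U (a + s *: v + r *: w)) ->
  exists2 x, (exists s r : R, [/\ 0 <= s <= 1, 0 <= r <= 1 & x = a + s *: v + r *: w]) &
    f (a + v + w) - f (a + v) - (f (a + w) - f a) = 'D_w (fun y => 'D_v f y) x.
Proof.
move=> f2 Ua.
have U0 (s : R) : 0 <= s <= 1 -> U (a + s *: v).
  by move=> s01; have := Ua s 0 s01; rewrite scale0r addr0; apply; rewrite lexx ler01.
have U1 (s : R) : 0 <= s <= 1 -> U (a + s *: v + w).
  by move=> s01; have := Ua s 1 s01; rewrite scale1r; apply; rewrite ler01 lexx.
have fd (s : R) : 0 <= s <= 1 ->
    is_derive (a + s *: v) v (fun x => f (x + w) - f x)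
      ('D_v f (a + s *: v + w) - 'D_v f (a + s *: v)).
  move=> s01; apply: is_deriveB.
    by apply: is_derive_translate; exact: Ck_on_derivable f2 (U1 _ s01).
  by apply: DeriveDef => //; exact: Ck_on_derivable f2 (U0 _ s01).
have [s s01] := line_MVT (fun s s01 => @ex_derive _ _ _ _ _ _ _ (fd s s01)).
rewrite (@derive_val _ _ _ _ _ _ _ (fd s s01)) => Es.
have [r r01 Er] := @line_MVT R _ (fun y => 'D_v f y) (a + s *: v) w (fun r r01 =>
  Ck_on_derivable (v := w) (Ck_on_derive v f2) (Ua s r s01 r01)).
exists (a + s *: v + r *: w); first by exists s, r.
by rewrite -Er -Es.
Qed.

Lemma derive2_scale_dir U (f : 'rV[R]_m -> R) (x v w : 'rV[R]_m) (t : R) :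
  open U -> Ck_on 2 U f -> U x ->
  'D_(t *: w) (fun y => 'D_(t *: v) f y) x = t * t * 'D_w (fun y => 'D_v f y) x.
Proof.
move=> oU f2 Ux.
have fv := Ck_on_derivable (v := w) (Ck_on_derive v f2) Ux.
have E : {near x, (fun y => 'D_(t *: v) f y) =1 t \*: (fun y => 'D_v f y)}.
  apply: near_open oU Ux _ => y Uy.
  exact: (@derive_val _ _ _ _ _ _ _ (is_derive_scale_dir t (Ck_on_derivable (v := v) f2 Uy))).
rewrite (near_eq_derive _ E).
have d1 : derivable (t \*: (fun y => 'D_v f y)) x w by exact: derivableZ.
rewrite (@derive_val _ _ _ _ _ _ _ (is_derive_scale_dir t d1)) deriveZ//.
by rewrite scalerA.
Qed.

(** The mixed second difference over the parallelogram spanned by t v and t w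
    is symmetric in v and w, and equals t^2 times either mixed derivative at
    some point near a; continuity lets t tend to 0. *)
Lemma schwarz_scalar U (f : 'rV[R]_m -> R) (a v w : 'rV[R]_m) :
  open U -> Ck_on 2 U f -> U a ->
  'D_w (fun y => 'D_v f y) a = 'D_v (fun y => 'D_w f y) a.
Proof.
move=> oU f2 Ua; apply/eqP; rewrite -subr_eq0 -normr_eq0.
apply/eqP/le_anti; rewrite normr_ge0 andbT; apply/ler_addgt0Pr => e e0; rewrite add0r.
have e2 : 0 < e / 2 by rewrite divr_gt0.
have close (z p q : R) : `|z - p| <= e / 2 -> `|z - q| <= e / 2 -> `|p - q| <= e.
  move=> zp zq; rewrite (splitr e) (le_trans (ler_distD z p q))// lerD//.
  by rewrite distrC.
have c1 := Ck_on_continuous (Ck_on_derive w (Ck_on_derive v f2)) Ua.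
have c2 := Ck_on_continuous (Ck_on_derive v (Ck_on_derive w f2)) Ua.
have [d1 d10 n1] := continuous_ball c1 e2.
have [d2 d20 n2] := continuous_ball c2 e2.
have [d3 d30 n3] := open_ball oU Ua.
pose d : R := Num.min d1 (Num.min d2 d3).
have d0 : 0 < d by rewrite !lt_min d10 d20 d30.
(* The parallelogram must stay within distance d of a. *)
have [t t0 td] : exists2 t : R, 0 < t & t * (`|v| + `|w|) < d.
  have vw : 0 < `|v| + `|w| + 1 by rewrite ltr_wpDl// addr_ge0.
  exists (d / (`|v| + `|w| + 1)); first exact: divr_gt0.
  by rewrite -mulrA -[ltRHS]mulr1 ltr_pM2l// ltr_pdivrMl// mulr1 ltrDl.
have near_a (s r : R) : 0 <= s <= 1 -> 0 <= r <= 1 ->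
    `|a + s *: (t *: v) + r *: (t *: w) - a| < d.
  move=> /andP[s0 s1] /andP[r0 r1]; rewrite -[a + _ + _]addrA [X in `|X|]addrAC subrr add0r.
  rewrite (le_lt_trans _ td)// (le_trans (ler_normD _ _))//.
  rewrite !normrZ (gtr0_norm t0) (ger0_norm s0) (ger0_norm r0).
  by rewrite mulrDr lerD// ler_piMl// mulr_ge0// ltW.
have Uv (s r : R) : 0 <= s <= 1 -> 0 <= r <= 1 -> U (a + s *: (t *: v) + r *: (t *: w)).
  move=> s01 r01; apply: n3; apply: lt_le_trans (near_a s r s01 r01) _.
  by rewrite /d !ge_min lexx !orbT.
have Uw (s r : R) : 0 <= s <= 1 -> 0 <= r <= 1 -> U (a + s *: (t *: w) + r *: (t *: v)).
  by move=> s01 r01; rewrite addrAC; exact: Uv.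
have [x [s [r [s01 r01 xE]]] Ex] := second_difference f2 Uv.
have [y [s' [r' [s01' r01' yE]]] Ey] := second_difference f2 Uw.
have Ux : U x by rewrite xE; exact: Uv.
have Uy : U y by rewrite yE; exact: Uw.
have xa : `|x - a| < d by rewrite xE; exact: near_a.
have ya : `|y - a| < d by rewrite yE [a + _ + _]addrAC; exact: near_a.
have xy : 'D_w (fun z => 'D_v f z) x = 'D_v (fun z => 'D_w f z) y.
  apply: (mulfI (lt0r_neq0 (mulr_gt0 t0 t0))).
  apply: etrans (esym (derive2_scale_dir v w t oU f2 Ux)) _.
  apply: etrans _ (derive2_scale_dir w v t oU f2 Uy).
  apply: etrans (esym Ex) (etrans _ Ey); rewrite [a + _ + t *: v]addrAC !opprB !addrA.
  rewrite addrAC [RHS]addrAC; congr (_ + _).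
  exact: addrAC.
have x1 : `|x - a| < d1 by apply: lt_le_trans xa _; rewrite /d ge_min lexx.
have y2 : `|y - a| < d2 by apply: lt_le_trans ya _; rewrite /d !ge_min lexx orbT.
have n1x := n1 _ x1; have := n2 _ y2; rewrite -xy => n2y.
apply: close n1x n2y.
Qed.

End Schwarz.

Section Schwarz_mx.
Context {R : realType} {m p q : nat}.

Lemma schwarz (U : set 'rV[R]_m) (f : 'rV[R]_m -> 'M[R]_(p, q)) (a v w : 'rV[R]_m) :
  open U -> smooth_on U f -> U a ->
  'D_w (fun y => 'D_v f y) a = 'D_v (fun y => 'D_w f y) a.
Proof.
move=> oU fs Ua.
have E (v' w' : 'rV[R]_m) i j : ('D_w' (fun y => 'D_v' f y) a) i j =
    'D_w' (fun y => 'D_v' (fun z => f z i j) y) a.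
  have d2 : derivable (fun y => 'D_v' f y) a w'.
    exact: smooth_on_derivable (smooth_on_derive v' fs) Ua.
  rewrite (derive_mx d2) mxE; apply: near_eq_derive.
  apply: near_open oU Ua _ => y Uy.
  by rewrite (derive_mx (smooth_on_derivable (v := v') fs Uy)) mxE.
apply/matrixP => i j; apply: etrans (E v w i j) (etrans _ (esym (E w v i j))).
exact: (schwarz_scalar v w oU ((smooth_on_mxP f oU).1 fs i j 2%N) Ua).
Qed.

End Schwarz_mx.

(** * Tools for Picard iteration *)

Section Primitive.
Context {R : realType}.

Lemma exists_primitive (h : R -> R) (e : R) : continuous h ->
  exists H : R -> R, H 0 = 0 /\ forall t : R, `|t| < e -> is_derive t (1 : R) H (h t).
Proof.
move=> hc.
pose F (x : R) : R := \int[@lebesgue_measure R]_(t in [set` `[- e, x]]) h t.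
have ih : (@lebesgue_measure R).-integrable `[- e, e] (EFin \o h).
  apply: continuous_compact_integrable; first exact: segment_compact.
  by apply: continuous_subspaceT.
exists (fun x => F x - F 0); split; first by rewrite subrr.
move=> t /[!ltr_norml] /andP[et te].
have [Fd FE] := continuous_FTC1_closed te ih et (hc t).
rewrite -[h t]subr0; apply: is_deriveB.
by apply: (DeriveDef Fd); apply: etrans FE; rewrite derive1E.
Qed.

Lemma exists_primitive_row {k} (h : R -> 'rV[R]_k) (e : R) : continuous h ->
  exists H : R -> 'rV[R]_k, H 0 = 0 /\ forall t : R, `|t| < e -> is_derive t (1 : R) H (h t).
Proof.
move=> hc.
have hj j : continuous (fun t => h t 0 j).
  by move=> t; move: (0 : 'I_1) j; apply/continuous_mxP; exact: hc.
have /choice[H HP] := fun j => exists_primitive e (hj j).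
exists (fun t => \row_j H j t); split.
  by apply/rowP => j; rewrite !mxE; case: (HP j).
move=> t te.
have d i j : derivable (fun t => (\row_j H j t) i j) t 1.
  by under eq_fun do rewrite mxE; have [_ /(_ t te)[]] := HP j.
have dH : derivable (fun t => \row_j H j t) t 1 by apply/derivable_mxP.
split=> //; rewrite derive_mx//; apply/rowP => j; rewrite mxE.
by under eq_fun do rewrite mxE; have [_ /(_ t te)[]] := HP j.
Qed.

(** Proved entry by entry, since the mean value theorem is for real functions. *)
Lemma primitive_bound {k} (H : R -> 'rV[R]_k) (h : R -> 'rV[R]_k) (e B t : R) :
  H 0 = 0 -> (forall t : R, `|t| < e -> is_derive t (1 : R) H (h t)) ->
  (forall t : R, `|t| < e -> `|h t| <= B) -> `|t| < e -> `|H t| <= `|t| * B.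
Proof.
move=> H0 Hd hB te.
have e0 : 0 < e by exact: le_lt_trans te.
have B0 : 0 <= B by apply: le_trans (hB 0 _); rewrite ?normr0.
apply: mx_norm_le => [|i j]; first exact: mulr_ge0.
rewrite {i}ord1.
have st (s : R) : 0 <= s <= 1 -> `|0 + s * t| < e.
  move=> /andP[s0 s1]; rewrite add0r normrM ger0_norm//.
  by apply: le_lt_trans te; rewrite ler_piMl.
have dj (s : R) : `|s| < e -> is_derive s 1 (fun x => H x 0 j) (h s 0 j).
  move=> se; have [ds Ds] := Hd s se; split; first exact: (derivable_mxP H s 1).1.
  by move: Ds; rewrite derive_mx// => /rowP/(_ j); rewrite mxE.
have djt (s : R) : 0 <= s <= 1 ->
    is_derive (0 + s * t) t (fun x => H x 0 j) (t * h (0 + s * t) 0 j).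
  move=> s01; have [d D] := dj _ (st _ s01).
  by have := is_derive_scale_dir t d; rewrite D [t *: 1]mulr1.
have [s s01] := @line_MVT R _ (fun x => H x 0 j) 0 t (fun s s01 =>
  @ex_derive _ _ _ _ _ _ _ (djt s s01)).
rewrite (@derive_val _ _ _ _ _ _ _ (djt s s01)) add0r H0 mxE subr0 => ->.
rewrite normrM ler_wpM2l// (le_trans (ler_norm_entry _ _ _))//.
by apply: hB; exact: st.
Qed.

(** Completeness in the form needed for Picard iterates: the limit comes with
    its rate of convergence.  It is the supremum of the lower bounds
    u n - C / 2 ^ n, each of which is below every u m + C / 2 ^ m. *)
Lemma dyadic_limit (u : nat -> R) (C : R) :
  (forall n i, `|u (n + i)%N - u n| <= C / 2 ^+ n) ->
  exists l, forall n, `|l - u n| <= C / 2 ^+ n.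
Proof.
move=> uC.
pose S := [set u n - C / 2 ^+ n | n in [set: nat]].
have ubS n : ubound S (u n + C / 2 ^+ n).
  move=> _ [m _ <-]; have [nm|mn] := leqP n m.
    have := uC n (m - n)%N; rewrite subnKC// ler_norml => /andP[_ H1].
    have := le_trans (normr_ge0 _) (uC m 0%N); lra.
  have := uC m (n - m)%N; rewrite (subnKC (ltnW mn)) ler_norml => /andP[H1 _].
  have := le_trans (normr_ge0 _) (uC n 0%N); lra.
have S0 : S !=set0 by exists (u 0%N - C / 2 ^+ 0), 0%N.
exists (sup S) => n.
have h1 : sup S <= u n + C / 2 ^+ n by apply: ge_sup => //; exact: ubS.
have h2 : u n - C / 2 ^+ n <= sup S.
  by apply: ub_le_sup; [exists (u 0%N + C / 2 ^+ 0); exact: ubS|exists n].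
by rewrite ler_norml; apply/andP; split; lra.
Qed.

(** Retraction of the line onto [a, b].  It extends functions known on an
    interval, or on a box, to globally defined ones with the same Lipschitz
    constant. *)
Definition clamp (a b x : R) : R := Num.max a (Num.min b x).

Lemma clamp_id a b x : a <= x <= b -> clamp a b x = x.
Proof. by move=> /andP[ax xb]; rewrite /clamp (min_idPr xb) (max_idPr ax). Qed.

Lemma clamp_bounds a b x : a <= b -> a <= clamp a b x <= b.
Proof.
by move=> ab; rewrite /clamp le_max lexx ge_max ab ge_min lexx.
Qed.

Lemma clamp_lipschitz a b x y : `|clamp a b x - clamp a b y| <= `|x - y|.
Proof.
have h1 := ler_norm (x - y); have h2 : y - x <= `|x - y| by rewrite distrC ler_norm.
have h3 := normr_ge0 (x - y).
rewrite /clamp ler_norml; apply/andP; split;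
 case: (leP b x) => ?; case: (leP b y) => ?; (try case: (leP a b) => ?);
 (try case: (leP a x) => ?); (try case: (leP a y) => ?); lra.
Qed.

Lemma clamp_continuous a b : continuous (clamp a b).
Proof.
move=> x; apply/cvgrPdist_le => /= e e0; near=> y.
apply: le_trans (clamp_lipschitz _ _ _ _) _; near: y.
exact: cvgr_dist_le.
Unshelve. all: by end_near. Qed.

End Primitive.

(** * Ordinary differential equations *)

Section Picard.
Context {R : realType} {k : nat}.

Lemma lipschitz_continuous (g : 'rV[R]_k -> 'rV[R]_k) (L : R) : 0 < L ->
  (forall x y, `|g x - g y| <= L * `|x - y|) -> continuous g.
Proof.
move=> L0 gL x; apply: continuous_of_ball => e e0.
exists (e / L); first exact: divr_gt0.
move=> y xy; rewrite (le_trans (gL _ _))// mulrC -ler_pdivlMr//.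
exact: ltW.
Qed.

(** Picard iteration on an interval of length 1 / L, on which each iterate
    halves the distance between two curves.  Time is clamped to [-e, e], so
    that all iterates are continuous on the whole line and the estimates hold
    for every t. *)
Lemma picard_lipschitz (g : 'rV[R]_k -> 'rV[R]_k) (L : R) (y0 : 'rV[R]_k) :
  0 < L -> (forall x y, `|g x - g y| <= L * `|x - y|) ->
  exists (e : R) (y : R -> 'rV[R]_k),
    [/\ 0 < e, y 0 = y0 & forall t : R, `|t| < e -> is_derive t (1 : R) y (g (y t))].
Proof.
move=> L0 gL; have gc := lipschitz_continuous L0 gL.
(* With e L = 1/2, the Picard map halves uniform distances on [-e, e]. *)
pose e : R := (2 * L)^-1.
have e0 : 0 < e by rewrite invr_gt0 mulr_gt0.
have eL : e * L = 2^-1 by rewrite /e invfM mulfVK// gt_eqF.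
have /choice[P HP] : forall h : R -> 'rV[R]_k, exists H : R -> 'rV[R]_k, continuous h ->
    H 0 = 0 /\ forall t : R, `|t| < 2 * e -> is_derive t (1 : R) H (h t).
  move=> h; have [hc|nhc] := pselect (continuous h); last by exists (fun=> 0).
  by have [H [H0 Hd]] := exists_primitive_row (2 * e) hc; exists H.
clearbody e.
have e2 : e < 2 * e by rewrite ltr_pMl// ltr1n.
pose c := clamp (- e) e.
have ce t : `|c t| <= e.
  by rewrite ler_norml clamp_bounds//; lra.
have ce2 t : `|c t| < 2 * e by exact: le_lt_trans (ce t) e2.
pose Phi (y : R -> 'rV[R]_k) (t : R) := y0 + P (fun s => g (y s)) (c t).
have gyc y : continuous y -> continuous (fun s : R => g (y s)).
  by move=> yc s; apply: continuous_comp; [exact: yc|exact: gc].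
have Pc (h : R -> 'rV[R]_k) : continuous h -> continuous (fun t => P h (c t)).
  move=> hc t; apply: continuous_comp; first exact: clamp_continuous.
  have [_ /(_ _ (ce2 t))[d _]] := HP h hc.
  exact/differentiable_continuous/derivable1_diffP.
have PhiC y : continuous y -> continuous (Phi y).
  move=> yc t; apply: continuousD; first exact: cst_continuous.
  by apply: Pc; exact: gyc.
have PhiB y z B : continuous y -> continuous z ->
    (forall t, `|y t - z t| <= B) -> forall t, `|Phi y t - Phi z t| <= B / 2.
  move=> yc zc yzB t; rewrite /Phi opprD addrACA subrr add0r.
  have [P10 P1] := HP _ (gyc _ yc); have [P20 P2] := HP _ (gyc _ zc).
  have := @primitive_bound R k (fun t => P (fun s => g (y s)) t - P (fun s => g (z s)) t)
    (fun t => g (y t) - g (z t)) (2 * e) (L * B) (c t).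
  rewrite P10 P20 subrr => /(_ erefl) H.
  apply: le_trans (H _ _ (ce2 t)) _.
  - by move=> s se; apply: is_deriveB; [exact: P1|exact: P2].
  - by move=> s _; rewrite (le_trans (gL _ _))// ler_wpM2l// ltW.
  have B0 : 0 <= B by exact: le_trans (yzB t).
  by rewrite mulrA [B / 2]mulrC -eL ler_wpM2r// ler_wpM2r// ltW.
pose Y n := iter n Phi (fun=> y0).
have YC n : continuous (Y n).
  by elim: n => [|n IH]; [move=> t; exact: cst_continuous|exact: PhiC].
pose C0 : R := 2 * e * `|g y0|.
have Y01 t : `|Y 1%N t - Y 0%N t| <= C0.
  rewrite /Y /= /Phi addrC addKr.
  have hc : continuous (fun s : R => g y0) by move=> s; exact: cst_continuous.
  have [P10 P1] := HP _ hc.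
  apply: le_trans (primitive_bound P10 P1 (fun _ _ => lexx _) (ce2 t)) _.
  by rewrite ler_wpM2r// ltW.
have Yn n t : `|Y n.+1 t - Y n t| <= C0 / 2 ^+ n.
  elim: n t => [|n IH] t; first by rewrite expr0 divr1.
  rewrite exprSr invfM mulrA; apply: (PhiB (Y n.+1) (Y n)) => //; exact: YC.
have C00 : 0 <= C0 by apply: le_trans (Y01 0).
have Yni n i t : `|Y (n + i)%N t - Y n t| <= 2 * C0 / 2 ^+ n.
  suff : `|Y (n + i)%N t - Y n t| <= 2 * C0 / 2 ^+ n - 2 * C0 / 2 ^+ (n + i).
    by move=> /le_trans; apply; rewrite gerBl divr_ge0// ?exprn_ge0// mulr_ge0.
  elim: i => [|i IH]; first by rewrite addn0 !subrr normr0.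
  rewrite addnS -(subrKA (Y (n + i)%N t)) (le_trans (ler_normD _ _))//.
  apply: le_trans (lerD (Yn _ _) IH) _.
  have -> : 2 * C0 / 2 ^+ (n + i).+1 = C0 / 2 ^+ (n + i).
    by rewrite exprS -mulf_div divff ?mul1r// pnatr_eq0.
  rewrite addrC -addrA lerD2l; lra.
have /choice[y Hy] : forall t, exists yt, forall n, `|yt - Y n t| <= 2 * C0 / 2 ^+ n.
  move=> t.
  have /choice[l Hl] : forall j, exists l, forall n, `|l - Y n t 0 j| <= 2 * C0 / 2 ^+ n.
    move=> j; apply: dyadic_limit => n i.
    apply: le_trans (Yni n i t).
    by have := ler_norm_entry (Y (n + i)%N t - Y n t) 0 j; rewrite !mxE.
  exists (\row_j l j) => n; apply: mx_norm_le => [|i j].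
    exact: le_trans (normr_ge0 _) (Yni n 0%N t).
  by rewrite ord1 !mxE.
have small d : 0 < d -> exists n, 2 * C0 / 2 ^+ n <= d.
  move=> d0; pose n := Num.bound (2 * C0 / d); exists n.
  rewrite ler_pdivrMr ?exprn_gt0// [d * _]mulrC -ler_pdivrMr// ltW//.
  apply: (@lt_le_trans _ _ n%:R); first by rewrite archi_boundP// divr_ge0 ?mulr_ge0// ltW.
  by rewrite -natrX ler_nat ltnW// ltn_expl.
have yc : continuous y.
  move=> t; apply/cvgrPdist_le => /= d d0.
  have d3 : 0 < d / 3 by rewrite divr_gt0.
  have [n nd] := small _ d3.
  have /cvgrPdist_le/(_ _ d3) := YC n t.
  apply: filterS => s ts.
  have -> : y t - y s = (y t - Y n t) + (Y n t - Y n s) + (Y n s - y s).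
    by rewrite subrKA subrKA.
  rewrite (le_trans (ler_normD _ _))// (_ : d = d / 3 + d / 3 + d / 3); last lra.
  rewrite lerD//; last by rewrite distrC (le_trans (Hy s n)).
  by rewrite (le_trans (ler_normD _ _))// lerD// (le_trans (Hy t n)).
have yfix t : y t = Phi y t.
  apply/eqP; rewrite -subr_eq0 -normr_le0; apply/ler_addgt0Pr => d d0; rewrite add0r.
  have d2 : 0 < d / 2 by rewrite divr_gt0.
  have [n nd] := small _ d2.
  rewrite -(subrKA (Y n.+1 t)) (le_trans (ler_normD _ _))// (splitr d) lerD//.
    apply: le_trans (Hy t n.+1) (le_trans _ nd).
    apply: ler_wpM2l; first exact: mulr_ge0.
    by rewrite lef_pV2 ?posrE ?exprn_gt0// ler_weXn2l// ler1n.
  have H := PhiB _ _ _ (YC n) yc (fun s => le_trans _ nd).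
  apply: le_trans (H _ t) _; first by move=> s; rewrite distrC; exact: Hy.
  by rewrite ler_pdivrMr// ler_peMr ?ler1n// ltW.
exists e, y; split=> //.
  rewrite yfix /Phi /c clamp_id; last by rewrite oppr_le0 !ltW.
  by have [-> _] := HP _ (gyc _ yc); rewrite addr0.
move=> t te.
have [P0 Pd] := HP _ (gyc _ yc).
have te2 : `|t| < 2 * e by exact: lt_trans te e2.
have H1 : is_derive t (1 : R) (fun s => y0 + P (fun s => g (y s)) s) (g (y t)).
  rewrite -[g (y t)]add0r; apply: is_deriveD; exact: Pd.
apply: near_eq_is_derive H1.
have [d d0 dt] : exists2 d : R, 0 < d & forall s : R, `|s - t| < d -> `|s| < e.
  exists (e - `|t|); first by rewrite subr_gt0.
  move=> s; rewrite ltrBrDr => /(le_lt_trans _); apply.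
  by rewrite -[X in `|X| <= _](subrK t) ler_normD.
apply/nbhs_ballP; exists d => // s; rewrite -ball_normE /= distrC => /dt se.
rewrite [RHS]yfix /Phi /c clamp_id//.
by move: se; rewrite ltr_norml => /andP[s1 s2]; rewrite !ltW.
Qed.

End Picard.

Section OrdinaryDifferentialEquation.
Context {R : realType} {k : nat}.
Implicit Types (U : set 'rV[R]_k).

(** Near a the partial derivatives are bounded by their values at a plus 1; the
    mean value theorem on a segment of the ball turns this into a Lipschitz
    bound. *)
Lemma C1_locally_lipschitz {p q} U (f : 'rV[R]_k -> 'M[R]_(p, q)) (a : 'rV[R]_k) :
  open U -> U a -> Ck_on 1 U f ->
  exists r L : R, [/\ 0 < r, 0 < L, (forall x, `|x - a| <= r -> U x) &
    forall x y, `|x - a| <= r -> `|y - a| <= r -> `|f x - f y| <= L * `|x - y|].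
Proof.
move=> oU Ua f1.
have [d1 d10 Ud1] := open_ball oU Ua.
pose D i x := 'D_(delta_mx 0 i) f x.
have Dc (i : 'I_k) := Ck_on_continuous (Ck_on_derive (delta_mx 0 i) f1) Ua.
have /choice[d2 Hd2] : forall i : 'I_k, exists d : R, 0 < d /\
    forall x, `|x - a| < d -> `|D i x| <= `|D i a| + 1.
  move=> i; have [d d0 Hd] := continuous_ball (Dc i) ltr01.
  exists d; split=> // x /Hd; rewrite -(subrK (D i a) (D i x)) => H.
  by rewrite addrC (le_trans (ler_normD _ _))// lerD2l.
pose d := \big[Num.min/d1]_i d2 i.
have d0 : 0 < d.
  rewrite /d; elim/big_ind: _ => // [x y x0 y0|i _]; first by rewrite lt_min x0.
  by case: (Hd2 i).
have dd1 : d <= d1 by exact: bigmin_le_id.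
have dd2 i : d <= d2 i by exact: bigmin_le.
clearbody d.
pose L : R := 1 + \sum_i (`|D i a| + 1).
have L0 : 0 < L by rewrite ltr_wpDr// sumr_ge0// => i _; exact: addr_ge0.
have rd : d / 2 < d by rewrite ltr_pdivrMr// ltr_pMr// ltr1n.
exists (d / 2), L; split => //.
- exact: divr_gt0.
- by move=> x xr; apply: Ud1; lra.
move=> x y xr yr; apply: mx_norm_le => [|i j]; first by rewrite mulr_ge0// ltW.
have zr (s : R) : 0 <= s <= 1 -> `|y + s *: (x - y) - a| < d.
  move=> /andP[s0 s1].
  have -> : y + s *: (x - y) - a = (1 - s) *: (y - a) + s *: (x - a).
    apply/rowP => l; rewrite !mxE; lra.
  apply: le_lt_trans rd.
  rewrite (le_trans (ler_normD _ _))// !normrZ (ger0_norm s0) ger0_norm ?subr_ge0//.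
  have : (1 - s) * `|y - a| <= (1 - s) * (d / 2) by rewrite ler_wpM2l// subr_ge0.
  have : s * `|x - a| <= s * (d / 2) by rewrite ler_wpM2l.
  lra.
have Uz (s : R) : 0 <= s <= 1 -> U (y + s *: (x - y)).
  by move=> s01; apply: Ud1; exact: lt_le_trans (zr s s01) dd1.
have fij : Ck_on 1 U (fun x => f x i j) by exact: (Ck_on_mxP 1 f oU).1.
have [s s01] := line_MVT (fun s s01 => Ck_on_derivable (v := x - y) fij (Uz s s01)).
rewrite [y + (x - y)]addrC subrK.
rewrite (@derive_val _ _ _ _ _ _ _ (C1_is_derive (x - y) oU (Uz s s01) fij)).
rewrite !mxE => ->.
rewrite (le_trans (ler_norm_sum _ _ _))// /L mulrDl mul1r mulr_suml ler_wpDl//.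
apply: ler_sum => l _; rewrite normrM mulrC ler_pM//; last exact: ler_norm_entry.
have := proj2 (Hd2 l) _ (lt_le_trans (zr s s01) (dd2 l)); apply: le_trans.
have dl := Ck_on_derivable (v := delta_mx 0 l) f1 (Uz s s01).
have := ler_norm_entry (D l (y + s *: (x - y))) i j.
by rewrite {1}/D (derive_mx dl) mxE.
Qed.

(** Composing f with the retraction onto a box around y0 makes it globally
    Lipschitz; the solution starts at the centre of the box and stays inside
    for a short time, where f is unchanged. *)
Lemma ode_exists U (f : 'rV[R]_k -> 'rV[R]_k) (y0 : 'rV[R]_k) :
  open U -> U y0 -> Ck_on 1 U f ->
  exists (e : R) (y : R -> 'rV[R]_k), [/\ 0 < e, y 0 = y0 &
    forall t : R, `|t| < e -> U (y t) /\ is_derive t (1 : R) y (f (y t))].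
Proof.
move=> oU Uy0 f1.
have [r [L [r0 L0 Ur fL]]] := C1_locally_lipschitz oU Uy0 f1.
pose cl (z : 'rV[R]_k) : 'rV[R]_k := \row_j clamp (y0 0 j - r) (y0 0 j + r) (z 0 j).
have clr z : `|cl z - y0| <= r.
  apply: mx_norm_le => [|i j]; first exact: ltW.
  rewrite ord1 !mxE ler_norml.
  have /andP[] : y0 0 j - r <= clamp (y0 0 j - r) (y0 0 j + r) (z 0 j) <= y0 0 j + r.
    by apply: clamp_bounds; lra.
  lra.
have clL z w : `|cl z - cl w| <= `|z - w|.
  apply: mx_norm_le => // i j; rewrite ord1 !mxE (le_trans (clamp_lipschitz _ _ _ _))//.
  by have := ler_norm_entry (z - w) 0 j; rewrite !mxE.
have clK z : `|z - y0| <= r -> cl z = z.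
  move=> zr; apply/rowP => j; rewrite mxE clamp_id//.
  have := le_trans (ler_norm_entry (z - y0) 0 j) zr; rewrite !mxE ler_norml.
  lra.
have gL x y : `|f (cl x) - f (cl y)| <= L * `|x - y|.
  by rewrite (le_trans (fL _ _ (clr _) (clr _)))// ler_wpM2l// ltW.
have [e [y [e0 yy0 yd]]] := picard_lipschitz y0 L0 gL.
have yc : {for (0 : R), continuous y}.
  have [d _] := yd 0 (eq_ind_r (fun z => z < e) e0 (normr0 R)).
  exact/differentiable_continuous/derivable1_diffP.
have [d d0 yr] := continuous_ball yc r0.
exists (Num.min d e), y; split => //; first by rewrite lt_min d0.
move=> t; rewrite lt_min => /andP[td te].
have ytr : `|y t - y0| <= r by rewrite -yy0; apply: yr; rewrite subr0.
split; first exact: Ur.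
by have := yd t te; rewrite clK.
Qed.

End OrdinaryDifferentialEquation.

(** * Christoffel symbols and right inverses *)

Section Gamma.
Context {R : realType} {q : nat}.
Implicit Types (A B : 'I_q -> 'M[R]_q) (v w : 'rV[R]_q).

Lemma gammaE A v w k : gamma A v w 0 k = (v *m A k *m w^T) 0 0.
Proof. by rewrite mxE. Qed.

Lemma gammaDl A v1 v2 w : gamma A (v1 + v2) w = gamma A v1 w + gamma A v2 w.
Proof. by apply/rowP => k; rewrite [RHS]mxE !gammaE !mulmxDl [LHS]mxE. Qed.

Lemma gammaDr A v w1 w2 : gamma A v (w1 + w2) = gamma A v w1 + gamma A v w2.
Proof. by apply/rowP => k; rewrite [RHS]mxE !gammaE linearD mulmxDr [LHS]mxE. Qed.

Lemma gammaZl A (a : R) v w : gamma A (a *: v) w = a *: gamma A v w.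
Proof. by apply/rowP => k; rewrite [RHS]mxE !gammaE -!scalemxAl [LHS]mxE. Qed.

Lemma gammaZr A (a : R) v w : gamma A v (a *: w) = a *: gamma A v w.
Proof. by apply/rowP => k; rewrite [RHS]mxE !gammaE linearZ -scalemxAr [LHS]mxE. Qed.

Lemma gamma_delta A i j k : gamma A (delta_mx 0 i) (delta_mx 0 j) 0 k = A k i j.
Proof. by rewrite gammaE trmx_delta -rowE -colE !mxE. Qed.

(** Reduces statements on Christoffel symbols to basis vectors. *)
Lemma gamma_sum A v w : gamma A v w =
  \sum_i \sum_j (v 0 i * w 0 j) *: gamma A (delta_mx 0 i) (delta_mx 0 j).
Proof.
apply/rowP => k; rewrite gammaE mxE [RHS]summxE.
under [RHS]eq_bigr do rewrite summxE.
rewrite [RHS]exchange_big; apply: eq_bigr => j _ /=.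
rewrite mxE big_distrl; apply: eq_bigr => i _ /=.
by rewrite [RHS]mxE gamma_delta [w^T _ _]mxE mulrAC.
Qed.

Lemma gamma_inj A B : (forall v w, gamma A v w = gamma B v w) -> A = B.
Proof.
move=> AB; apply/funext => k; apply/matrixP => i j.
by rewrite -!gamma_delta AB.
Qed.

Lemma smooth_on_gamma {m} (U : set 'rV[R]_m) (A : 'rV[R]_m -> 'I_q -> 'M[R]_q)
    (v w : 'rV[R]_m -> 'rV[R]_q) : open U ->
  (forall k, smooth_on U (fun u => A u k)) -> smooth_on U v -> smooth_on U w ->
  smooth_on U (fun u => gamma (A u) (v u) (w u)).
Proof.
move=> oU As vs ws; apply/(smooth_on_mxP _ oU) => i k; under eq_fun do rewrite mxE.
apply: (smooth_on_mxP (fun u => v u *m A u k *m (w u)^T) oU).1 => //.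
apply: smooth_on_mulmx => //; last exact: smooth_on_trmx.
exact: smooth_on_mulmx.
Qed.

Lemma is_derive_trmx {V : normedModType R} {p r} (w : V -> 'M[R]_(p, r)) (a x : V) :
  derivable w a x -> is_derive a x (fun u => (w u)^T) ('D_x w a)^T.
Proof.
move=> dw.
have d : derivable (fun u => (w u)^T) a x.
  apply/derivable_mxP => i j; under eq_fun do rewrite mxE.
  exact: (derivable_mxP w a x).1.
apply: (DeriveDef d); rewrite (derive_mx d) (derive_mx dw); apply/matrixP => i j.
by rewrite !mxE; under eq_fun do rewrite mxE.
Qed.

Lemma is_derive_gamma {V : normedModType R} (A : V -> 'I_q -> 'M[R]_q)
    (v w : V -> 'rV[R]_q) (a x : V) :
  (forall k, derivable (fun u => A u k) a x) -> derivable v a x -> derivable w a x ->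
  is_derive a x (fun u => gamma (A u) (v u) (w u))
    (gamma (fun k => 'D_x (fun u => A u k) a) (v a) (w a) +
     gamma (A a) ('D_x v a) (w a) + gamma (A a) (v a) ('D_x w a)).
Proof.
move=> dA dv dw.
have dwT := is_derive_trmx dw.
have dvA k : is_derive a x (fun u => v u *m A u k)
    ('D_x v a *m A a k + v a *m 'D_x (fun u => A u k) a) by exact: is_derive_mulmx.
have dk k : is_derive a x (fun u => v u *m A u k *m (w u)^T)
    (('D_x v a *m A a k + v a *m 'D_x (fun u => A u k) a) *m (w a)^T +
      v a *m A a k *m ('D_x w a)^T).
  have [d1 e1] := dvA k; have [d2 e2] := dwT.
  by have := is_derive_mulmx d1 d2; rewrite e1 e2.
have dij i k : is_derive a x (fun u => gamma (A u) (v u) (w u) i k)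
   ((gamma (fun k => 'D_x (fun u => A u k) a) (v a) (w a) +
     gamma (A a) ('D_x v a) (w a) + gamma (A a) (v a) ('D_x w a)) i k).
  have -> : (fun u => gamma (A u) (v u) (w u) i k) =
            (fun u => (v u *m A u k *m (w u)^T) 0 0).
    by apply/funext => u; rewrite ord1 mxE.
  have [d e] := dk k; apply: DeriveDef; first exact: (derivable_mxP _ a x).1 d 0 0.
  have := derive_mx d; rewrite e => /matrixP/(_ 0 0); rewrite [RHS]mxE => <-.
  rewrite ord1 [LHS]mxE [RHS]mxE [X in _ = X + _]mxE !gammaE; congr (_ + _).
  by rewrite mulmxDl [LHS]mxE addrC.
have d : derivable (fun u => gamma (A u) (v u) (w u)) a x.
  by apply/derivable_mxP => i k; case: (dij i k).
apply: (DeriveDef d); rewrite (derive_mx d); apply/matrixP => i k.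
by rewrite mxE; case: (dij i k).
Qed.

End Gamma.

Section RightInverse.
Context {R : realType}.

(** A right inverse of T that depends smoothly on T, contrary to [pinvmx], which
    involves a choice of pivots. *)
Definition rinv {p q} (T : 'M[R]_(p, q)) : 'M[R]_(q, p) := T^T *m invmx (T *m T^T).

(** Over a real field, x T T^t = 0 gives |x T|^2 = 0. *)
Lemma gram_unit {p q} (T : 'M[R]_(p, q)) : row_free T -> T *m T^T \in unitmx.
Proof.
move=> fT; rewrite -row_free_unit; apply: inj_row_free => x.
rewrite mulmxA => xTT.
have : x *m T *m (x *m T)^T = 0 by rewrite trmx_mul mulmxA xTT mul0mx.
move=> /matrixP/(_ 0 0); rewrite [in LHS]mxE [RHS]mxE.
under eq_bigr do rewrite [(_^T) _ _]mxE -expr2.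
move=> /eqP; rewrite psumr_eq0 => [/allP H|j _]; last exact: sqr_ge0.
have xT : x *m T = 0.
  apply/rowP => j; rewrite [RHS]mxE; apply/eqP.
  by have := H j (mem_index_enum j); rewrite sqrf_eq0.
by apply: (row_free_inj fT); rewrite xT mul0mx.
Qed.

Lemma mulmx_rinv {p q} (T : 'M[R]_(p, q)) : row_free T -> T *m rinv T = 1%:M.
Proof. by move=> fT; rewrite /rinv mulmxA mulmxV// gram_unit. Qed.

Lemma mulmx_rinvK {p q r} (T : 'M[R]_(p, q)) (A : 'M[R]_(r, q)) : row_free T ->
  (A <= T)%MS -> A *m rinv T *m T = A.
Proof. by move=> fT /submxP[B ->]; rewrite -[B *m T *m _]mulmxA mulmx_rinv// mulmx1. Qed.

Lemma smooth_on_rinv {m p q} (U : set 'rV[R]_m) (T : 'rV[R]_m -> 'M[R]_(p, q)) :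
  open U -> (forall u, U u -> row_free (T u)) -> smooth_on U T ->
  smooth_on U (fun u => rinv (T u)).
Proof.
move=> oU fT Ts; have TTs := smooth_on_trmx oU Ts.
apply: smooth_on_mulmx => //; apply: smooth_on_invmx => //.
  by move=> u /fT; exact: gram_unit.
exact: smooth_on_mulmx.
Qed.

End RightInverse.

(** * Second derivatives of maps between coordinate spaces *)

Section SecondDerivative.
Context {R : realType} {p q : nat}.
Implicit Types (U : set 'rV[R]_p) (F : 'rV[R]_p -> 'rV[R]_q) (G : 'I_q -> 'M[R]_q).

(** The second derivative d^2F(v, w) at u, in the form in which it occurs in the
    transformation law of connections. *)
Definition hess F (u v w : 'rV[R]_p) : 'rV[R]_q := 'D_v (fun x => w *m 'J F x) u.

(** The covariant derivative along v of the image by F of the constant field w,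
    for the connection with coefficients G at the point F u. *)
Definition cov_hess F G (u v w : 'rV[R]_p) : 'rV[R]_q :=
  hess F u v w + gamma G (v *m 'J F u) (w *m 'J F u).

Lemma smooth_on_mulmx_jacobian U F (w : 'rV[R]_p) : open U -> smooth_on U F ->
  smooth_on U (fun x => w *m 'J F x).
Proof.
move=> oU Fs; apply: smooth_on_mulmx => //; first exact: smooth_on_cst.
exact: smooth_on_jacobian.
Qed.

Lemma mulmx_jacobian U F (v u : 'rV[R]_p) : open U -> smooth_on U F -> U u ->
  v *m 'J F u = 'D_v F u.
Proof.
by move=> oU Fs Uu; rewrite deriveEjacobian//; exact: smooth_on_differentiable oU Fs Uu.
Qed.

Lemma hessE U F (u v w : 'rV[R]_p) : open U -> smooth_on U F -> U u ->
  hess F u v w = 'D_v (fun x => 'D_w F x) u.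
Proof.
move=> oU Fs Uu; apply: near_eq_derive; apply: (near_open oU Uu) => x Ux.
exact: mulmx_jacobian oU Fs Ux.
Qed.

Lemma hess_sym U F (u v w : 'rV[R]_p) : open U -> smooth_on U F -> U u ->
  hess F u v w = hess F u w v.
Proof.
move=> oU Fs Uu; apply: etrans (hessE v w oU Fs Uu) _.
by apply: etrans (esym (hessE w v oU Fs Uu)); exact: schwarz oU Fs Uu.
Qed.

Lemma hess_jacobian U F (u v w : 'rV[R]_p) : open U -> smooth_on U F -> U u ->
  hess F u v w = w *m 'D_v (fun x => 'J F x) u.
Proof.
move=> oU Fs Uu; have dJ := smooth_on_derivable (v := v) (smooth_on_jacobian oU Fs) Uu.
by have [_] := is_derive_mulmxl w dJ.
Qed.

Lemma hessDr U F (u v w1 w2 : 'rV[R]_p) : open U -> smooth_on U F -> U u ->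
  hess F u v (w1 + w2) = hess F u v w1 + hess F u v w2.
Proof. by move=> oU Fs Uu; rewrite !(hess_jacobian _ _ oU Fs Uu) mulmxDl. Qed.

Lemma hessZr U F (u v w : 'rV[R]_p) (a : R) : open U -> smooth_on U F -> U u ->
  hess F u v (a *: w) = a *: hess F u v w.
Proof. by move=> oU Fs Uu; rewrite !(hess_jacobian _ _ oU Fs Uu) scalemxAl. Qed.

Lemma smooth_on_hess U F (v w : 'rV[R]_p) : open U -> smooth_on U F ->
  smooth_on U (fun u => hess F u v w).
Proof. by move=> oU Fs; apply: smooth_on_derive; exact: smooth_on_mulmx_jacobian. Qed.

Section Bilinear.
Variables (U : set 'rV[R]_p) (F : 'rV[R]_p -> 'rV[R]_q) (G : 'I_q -> 'M[R]_q).
Variable (u : 'rV[R]_p).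
Hypotheses (oU : open U) (Fs : smooth_on U F) (Uu : U u).

Lemma cov_hessDr v w1 w2 : cov_hess F G u v (w1 + w2) = cov_hess F G u v w1 + cov_hess F G u v w2.
Proof. by rewrite /cov_hess (hessDr _ _ _ oU Fs Uu) mulmxDl gammaDr addrACA. Qed.

Lemma cov_hessZr v (a : R) w : cov_hess F G u v (a *: w) = a *: cov_hess F G u v w.
Proof. by rewrite /cov_hess (hessZr _ _ _ oU Fs Uu) -scalemxAl gammaZr scalerDr. Qed.

Lemma cov_hessDl v1 v2 w : cov_hess F G u (v1 + v2) w = cov_hess F G u v1 w + cov_hess F G u v2 w.
Proof.
rewrite /cov_hess (hess_sym _ w oU Fs Uu) (hess_sym v1 w oU Fs Uu) (hess_sym v2 w oU Fs Uu).
by rewrite (hessDr _ _ _ oU Fs Uu) mulmxDl gammaDl addrACA.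
Qed.

Lemma cov_hessZl (a : R) v w : cov_hess F G u (a *: v) w = a *: cov_hess F G u v w.
Proof.
rewrite /cov_hess (hess_sym _ w oU Fs Uu) (hess_sym v w oU Fs Uu).
by rewrite (hessZr _ _ _ oU Fs Uu) -scalemxAl gammaZl scalerDr.
Qed.

(** Bilinearity determines the form from its values on basis vectors. *)
Lemma cov_hess_sum v w : cov_hess F G u v w =
  \sum_i \sum_j (v 0 i * w 0 j) *: cov_hess F G u (delta_mx 0 i) (delta_mx 0 j).
Proof.
have sum_r v' (I : Type) (r : seq I) (g : I -> 'rV[R]_p) :
    cov_hess F G u v' (\sum_(i <- r) g i) = \sum_(i <- r) cov_hess F G u v' (g i).
  elim: r => [|i r IH]; last by rewrite !big_cons cov_hessDr IH.
  by rewrite !big_nil -(scale0r (0 : 'rV[R]_p)) cov_hessZr !scale0r.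
have sum_l w' (I : Type) (r : seq I) (g : I -> 'rV[R]_p) :
    cov_hess F G u (\sum_(i <- r) g i) w' = \sum_(i <- r) cov_hess F G u (g i) w'.
  elim: r => [|i r IH]; last by rewrite !big_cons cov_hessDl IH.
  by rewrite !big_nil -(scale0r (0 : 'rV[R]_p)) cov_hessZl !scale0r.
rewrite {1}[v]row_sum_delta sum_l; apply: eq_bigr => i _.
rewrite {1}[w]row_sum_delta sum_r; apply: eq_bigr => j _.
by rewrite cov_hessZl cov_hessZr scalerA.
Qed.

Lemma cov_hess_sym : (forall a b, gamma G a b = gamma G b a) ->
  forall v w, cov_hess F G u v w = cov_hess F G u w v.
Proof.
by move=> Gs v w; rewrite /cov_hess (hess_sym _ _ oU Fs Uu) Gs.
Qed.

End Bilinear.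

End SecondDerivative.

Section ChainRule.
Context {R : realType} {p q r : nat}.
Variables (U : set 'rV[R]_p) (U' : set 'rV[R]_q).
Variables (F : 'rV[R]_p -> 'rV[R]_q) (f : 'rV[R]_q -> 'rV[R]_r) (H : 'rV[R]_p -> 'rV[R]_r).
Variable (u : 'rV[R]_p).
Hypotheses (oU : open U) (oU' : open U') (Fs : smooth_on U F) (fs : smooth_on U' f).
Hypotheses (FU : forall x, U x -> U' (F x)) (HE : forall x, U x -> H x = f (F x)) (Uu : U u).

Lemma chain_smooth : smooth_on U H.
Proof.
apply: (eq_smooth_on oU _ (smooth_on_comp oU oU' FU fs Fs)) => x Ux.
by rewrite HE.
Qed.

Lemma chain_jacobian x : U x -> 'J H x = 'J F x *m 'J f (F x).
Proof.
move=> Ux.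
have dF := smooth_on_differentiable oU Fs Ux.
have df := smooth_on_differentiable oU' fs (FU Ux).
apply: etrans (jacobian_comp dF df).
apply: near_eq_jacobian; first by apply: (near_open oU Ux) => y Uy; rewrite HE.
  exact: smooth_on_differentiable oU chain_smooth Ux.
exact: differentiable_comp.
Qed.

(** Differentiate the chain rule w JH = (w JF) Jf(F) along v. *)
Lemma chain_hess v w : hess H u v w =
  hess F u v w *m 'J f (F u) + hess f (F u) (v *m 'J F u) (w *m 'J F u).
Proof.
have E : {near u, (fun x => w *m 'J H x) =1 (fun x => (w *m 'J F x) *m 'J f (F x))}.
  by apply: (near_open oU Uu) => x Ux; rewrite chain_jacobian// mulmxA.
rewrite /hess (near_eq_derive v E).
have Jfs := smooth_on_jacobian oU' fs.
have dF := smooth_on_differentiable oU Fs Uu.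
have dJ := smooth_on_differentiable oU' Jfs (FU Uu).
have dwJ := smooth_on_derivable (v := v) (smooth_on_mulmx_jacobian w oU Fs) Uu.
have dJF : derivable (fun x => 'J f (F x)) u v.
  exact/diff_derivable/(differentiable_comp dF dJ).
rewrite (derive_mulmx dwJ dJF); congr (_ + _).
have -> : 'D_v (fun x => 'J f (F x)) u = 'D_(v *m 'J F u) (fun y => 'J f y) (F u).
  apply: etrans (derive_comp v dF dJ) _.
  by rewrite -(mulmx_jacobian v oU Fs Uu).
exact: esym (hess_jacobian _ _ oU' fs (FU Uu)).
Qed.

(** The hypothesis is the transformation law between connection coefficients in
    two charts of the target: it says exactly that the non-tensorial terms of
    the second derivative of the composite cancel. *)
Lemma cov_hess_postcomp G1 G2 v w :
  (forall a b, gamma G1 a b *m 'J f (F u) =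
     hess f (F u) a b + gamma G2 (a *m 'J f (F u)) (b *m 'J f (F u))) ->
  cov_hess H G2 u v w = cov_hess F G1 u v w *m 'J f (F u).
Proof.
move=> G12; rewrite /cov_hess chain_hess mulmxDl G12 -addrA; congr (_ + (_ + _)).
by rewrite chain_jacobian// !mulmxA.
Qed.

(** A change of coordinates in the source adds the inhomogeneous term of the
    transformation law of connections. *)
Lemma cov_hess_precomp G v w :
  cov_hess H G u v w = hess F u v w *m 'J f (F u) +
    cov_hess f G (F u) (v *m 'J F u) (w *m 'J F u).
Proof. by rewrite /cov_hess chain_hess -addrA chain_jacobian// !mulmxA. Qed.

End ChainRule.

(** * Charts *)

Section Charts.
Context {R : realType} {p : nat} {V : manifold R p}.

Lemma cod_param (c : chart V) u : cod c u -> dom V c (param V c u).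
Proof. by case=> x cx <-; rewrite coordK. Qed.

Lemma paramK (c : chart V) u : cod c u -> coord V c (param V c u) = u.
Proof. by case=> x cx <-; rewrite coordK. Qed.

Lemma open_cod (c : chart V) : open (cod c).
Proof. exact: cod_open. Qed.

Lemma cod_coord (c : chart V) x : dom V c x -> cod c (coord V c x).
Proof. by move=> cx; exists x. Qed.

End Charts.

Section LocalExpr.
Context {R : realType} {p m : nat} {V : manifold R p} {M : manifold R m} (i : V -> M).

Lemma local_domP (c : chart V) (d : chart M) u :
  local_dom i c d u <-> cod c u /\ dom M d (i (param V c u)).
Proof.
split=> [[x [cx dx] <-]|[cu du]]; first by rewrite coordK//; split=> //; exists x.
by exists (param V c u); [split=> //; exact: cod_param|exact: paramK].
Qed.

Lemma open_local_dom (c : chart V) (d : chart M) : continuous i -> open (local_dom i c d).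
Proof.
move=> ic; rewrite openE => u /local_domP[cu du].
have ipc : {for u, continuous (i \o param V c)}.
  by apply: continuous_comp; [exact: param_continuous|exact: ic].
have n1 := open_nbhs_nbhs (conj (@open_cod _ _ _ c) cu).
have n2 : \forall x \near u, dom M d (i (param V c x)).
  exact: ipc (open_nbhs_nbhs (conj (dom_open d) du)).
by apply: filterS2 n1 n2 => x cx dx; apply/local_domP.
Qed.

Lemma local_expr_cod (c : chart V) (d : chart M) u :
  local_dom i c d u -> cod d (local_expr i c d u).
Proof. by move=> /local_domP[_ du]; exact: cod_coord. Qed.

Lemma param_local_expr (c : chart V) (d : chart M) u :
  local_dom i c d u -> param M d (local_expr i c d u) = i (param V c u).
Proof. by move=> /local_domP[_ du]; rewrite /local_expr /= coordK. Qed.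

(** Charts of the ambient manifold are changed by composition on the left. *)
Lemma local_expr_target (c : chart V) (d d' : chart M) u :
  local_dom i c d u -> local_dom i c d' u ->
  overlap d d' (local_expr i c d u) /\
  local_expr i c d' u = transition d d' (local_expr i c d u).
Proof.
move=> du /local_domP[_ d'u]; have /local_domP[_ iu] := du; split.
  by exists (i (param V c u)).
by rewrite /transition /= param_local_expr.
Qed.

(** Charts of the hypersurface are changed by composition on the right. *)
Lemma local_expr_source (c c' : chart V) (d : chart M) u :
  local_dom i c d u -> overlap c c' u ->
  local_dom i c' d (transition c c' u) /\
  local_expr i c d u = local_expr i c' d (transition c c' u).
Proof.
move=> /local_domP[cu du] [x [cx c'x] xu]; subst u.
have E : param V c' (transition c c' (coord V c x)) = x.
  by rewrite /transition /= coordK// coordK.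
move: du; rewrite coordK// => du; split.
  by exists x; rewrite /transition /= ?coordK.
by rewrite /local_expr /= E coordK.
Qed.

End LocalExpr.

Section Overlaps.
Context {R : realType} {p : nat} {V : manifold R p}.

(** An overlap of charts is the domain of the local expression of the identity. *)
Lemma open_overlap (c c' : chart V) : open (overlap c c').
Proof. exact: (@open_local_dom _ _ _ V V id c c' (fun x => @cvg_id _ (nbhs x))). Qed.

Lemma overlap_cod (c c' : chart V) u : overlap c c' u -> cod c u.
Proof. by case=> x [cx _] <-; exists x. Qed.

Lemma smooth_transition (c c' : chart V) : smooth_on (overlap c c') (transition c c').
Proof. exact: transition_smooth. Qed.

Lemma connection_change (D : affine_connection V) (c c' : chart V) u v w :
  overlap c c' u ->
  gamma (D c u) v w *m 'J (transition c c') u =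
  hess (transition c c') u v w +
  gamma (D c' (transition c c' u)) (v *m 'J (transition c c') u)
    (w *m 'J (transition c c') u).
Proof. exact: conn_change. Qed.

End Overlaps.

(** * Covariant derivative and curvature in coordinates *)

Lemma cov_id {R : realType} {k} {Q : manifold R k} (A : affine_connection Q) (c : chart Q)
    (X : 'rV[R]_k) (Y : 'rV[R]_k -> 'rV[R]_k) u :
  cov A c id X Y u = 'D_X Y u + gamma (A c u) X (Y u).
Proof. by rewrite /cov jacobian_id mulmx1. Qed.

Lemma near_eq_cov {R : realType} {m p : nat} {M : manifold R m} (D : affine_connection M)
    (d : chart M) (F : 'rV[R]_p -> 'rV[R]_m) (X : 'rV[R]_p)
    (Y Y' : 'rV[R]_p -> 'rV[R]_m) (u : 'rV[R]_p) :
  {near u, Y =1 Y'} -> cov D d F X Y u = cov D d F X Y' u.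
Proof. by move=> YY; rewrite /cov (near_eq_derive X YY) (nbhs_singleton YY). Qed.

(** The classical formula for the curvature in terms of connection coefficients
    and their first derivatives. *)
Lemma curvatureE {R : realType} {k} {Q : manifold R k} (A : affine_connection Q) (c : chart Q)
    (u X Y Z : 'rV[R]_k) :
  cod c u ->
  curvature A c u X Y Z =
    (gamma (fun j => 'D_X (fun x => A c x j) u) Y Z + gamma (A c u) X (gamma (A c u) Y Z)) -
    (gamma (fun j => 'D_Y (fun x => A c x j) u) X Z + gamma (A c u) Y (gamma (A c u) X Z)).
Proof.
move=> cu.
have inner X' : cov A c id X' (cst Z) = (fun x => gamma (A c x) X' Z).
  by apply/funext => x; rewrite cov_id derive_cst add0r.
have outer X' Y' : cov A c id X' (cov A c id Y' (cst Z)) u =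
    gamma (fun j => 'D_X' (fun x => A c x j) u) Y' Z + gamma (A c u) X' (gamma (A c u) Y' Z).
  rewrite inner cov_id; congr (_ + _).
  have dA j : derivable (fun x => A c x j) u X'.
    exact: smooth_on_derivable (conn_smooth A c j) cu.
  have [_ ->] := is_derive_gamma dA (derivable_cst Y' u X') (derivable_cst Z u X').
  rewrite !derive_cst /cst /=.
  rewrite -(scale0r (0 : 'rV[R]_k)) gammaZl gammaZr !scale0r !addr0.
  by [].
by rewrite /curvature !outer.
Qed.

(** * Existence of geodesics *)

Section Curves.
Context {R : realType}.

Lemma is_derive_curve {W Z : normedModType R} (f : W -> Z) (x : R -> W) (t : R) :
  derivable x t 1 -> differentiable f (x t) ->
  is_derive t (1 : R) (f \o x) ('D_('D_1 x t) f (x t)).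
Proof.
move=> /derivable1_diffP dx df; split.
  by apply: diff_derivable; exact: differentiable_comp.
exact: derive_comp.
Qed.

Lemma near_ball0 (e t : R) : `|t| < e -> \forall s \near t, `|s| < e.
Proof.
move=> te; apply/nbhs_ballP; exists (e - `|t|); first by rewrite /= subr_gt0.
move=> s; rewrite -ball_normE /= distrC ltrBrDr => /(le_lt_trans _); apply.
by rewrite -[X in `|X| <= _](subrK t) ler_normD.
Qed.

End Curves.

Section GeodesicExistence.
Context {R : realType} {m : nat} {M : manifold R m} (D : affine_connection M).

(** The geodesic equation is the first-order system (x, v)' = (v, -Gamma(v, v)),
    whose right-hand side is smooth on the open set where x is in the image of
    the chart.  The solution satisfies the equation in every other chart by
    the transformation law of the connection. *)
Lemma geodesic_exists (d : chart M) (x0 v0 : 'rV[R]_m) : cod d x0 ->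
  exists (e : R) (crv : R -> M), [/\ geodesic D e crv, crv 0 = param M d x0 &
    derive1 (coord M d \o crv) 0 = v0].
Proof.
move=> dx0.
pose pos : 'M[R]_(m + m, m) := col_mx 1%:M 0.
pose vel : 'M[R]_(m + m, m) := col_mx 0 1%:M.
(* Multiplication by [tpos] and [tvel] injects positions and velocities into
   the phase space, [pos] and [vel] project it. *)
pose tpos : 'M[R]_(m, m + m) := row_mx 1%:M 0.
pose tvel : 'M[R]_(m, m + m) := row_mx 0 1%:M.
have pp : tpos *m pos = 1%:M by rewrite mul_row_col mulmx1 mul0mx addr0.
have pv : tpos *m vel = 0 by rewrite mul_row_col mulmx0 mul0mx addr0.
have vp : tvel *m pos = 0 by rewrite mul_row_col mulmx0 mul0mx addr0.
have vv : tvel *m vel = 1%:M by rewrite mul_row_col mulmx1 mul0mx add0r.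
pose acc (z : 'rV[R]_(m + m)) := gamma (D d (z *m pos)) (z *m vel) (z *m vel).
pose U := [set z : 'rV[R]_(m + m) | cod d (z *m pos)].
pose f (z : 'rV[R]_(m + m)) := z *m vel *m tpos + acc z *m - tvel.
have lins (A : 'M[R]_(m + m, m)) (W : set 'rV[R]_(m + m)) :
    open W -> smooth_on W (fun z => z *m A).
  by move=> oW; apply: smooth_on_mulmx => //; [exact: smooth_on_id|exact: smooth_on_cst].
have oU : open U.
  have cpos : continuous (fun z : 'rV[R]_(m + m) => z *m pos).
    by move=> z; exact: (smooth_on_continuous (lins pos setT openT)).
  by apply: open_comp (@open_cod _ _ _ d) => z _; exact: cpos.
have fs : smooth_on U f.
  apply: smooth_onD => //.
    by apply: smooth_on_mulmx => //; [exact: lins|exact: smooth_on_cst].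
  apply: smooth_on_mulmx => //; last exact: smooth_on_cst.
  apply: smooth_on_gamma => //; try exact: lins.
  move=> k; apply: (smooth_on_comp oU (@open_cod _ _ _ d) _ (conn_smooth D d k)) => //.
  exact: lins.
have Uy0 : U (x0 *m tpos + v0 *m tvel).
  by rewrite /U /= mulmxDl -!mulmxA pp vp mulmx1 mulmx0 addr0.
have [e [y [e0 y0 yd]]] := ode_exists oU Uy0 (fs 1%N).
pose x t := y t *m pos; pose v t := y t *m vel.
have xd t : `|t| < e -> is_derive t (1 : R) x (v t).
  move=> /yd[_ [dy Dy]]; have [dx Dx] := is_derive_mulmxr pos dy.
  split=> //; rewrite Dx Dy /f mulmxDl -!mulmxA mulNmx pp vp.
  by rewrite oppr0 !mulmx0 mulmx1 addr0.
have vd t : `|t| < e -> is_derive t (1 : R) v (- gamma (D d (x t)) (v t) (v t)).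
  move=> /yd[_ [dy Dy]]; have [dx Dx] := is_derive_mulmxr vel dy.
  split=> //; rewrite Dx Dy /f mulmxDl -!mulmxA mulNmx pv vv.
  by rewrite !mulmx0 add0r mulmxN mulmx1.
have xU t : `|t| < e -> cod d (x t) by move=> /yd[].
have crv0 : `|0 : R| < e by rewrite normr0.
have x00 : x 0 = x0 by rewrite /x y0 mulmxDl -!mulmxA pp vp mulmx1 mulmx0 addr0.
have v00 : v 0 = v0 by rewrite /v y0 mulmxDl -!mulmxA pv vv mulmx1 mulmx0 add0r.
have xc t : `|t| < e -> {for t, continuous x}.
  by move=> /xd[dx _]; exact/differentiable_continuous/derivable1_diffP.
exists e, (fun t => param M d (x t)); split; last 2 first.
- by rewrite x00.
- rewrite derive1E -v00; have [_ <-] := xd 0 crv0; apply: near_eq_derive.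
  apply: filterS (near_ball0 crv0) => t te.
  by rewrite /= paramK//; exact: xU.
split=> // t te; split.
  by apply: continuous_comp; [exact: xc|exact/param_continuous/xU].
move=> d' d't X.
pose f' := transition d d'.
have oU' := @open_overlap _ _ M d d'.
have fs' := @smooth_transition _ _ M d d'.
have xt : overlap d d' (x t).
  by apply/(@local_domP _ _ _ M M id); split; [exact: xU|].
have n1 : \forall s \near t, `|s| < e /\ overlap d d' (x s).
  by apply: filterI; [exact: near_ball0|exact: xc te _ (open_nbhs_nbhs (conj oU' xt))].
have XE : X = f' \o x by [].
have Xd s : `|s| < e -> overlap d d' (x s) ->
    is_derive s (1 : R) X (v s *m 'J f' (x s)).
  move=> se xs; have [dx Dx] := xd s se.
  have df := smooth_on_differentiable oU' fs' xs.
  have := is_derive_curve dx df.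
  by rewrite Dx (mulmx_jacobian _ oU' fs' xs).
have X1 : {near t, derive1 X =1 (fun s => v s *m 'J f' (x s))}.
  by apply: filterS n1 => s [se xs]; rewrite derive1E; case: (Xd s se xs).
have [dv Dv] := vd t te; have [dx Dx] := xd t te.
have dJ := is_derive_curve dx (smooth_on_differentiable oU' (smooth_on_jacobian oU' fs') xt).
have [dJ1 DJ1] := dJ; rewrite Dx in DJ1.
have dvJ := is_derive_mulmx dv dJ1.
have X2 : is_derive t (1 : R) (derive1 X)
   (- gamma (D d (x t)) (v t) (v t) *m 'J f' (x t) + hess f' (x t) (v t) (v t)).
  apply: (@near_eq_is_derive _ _ _ (fun s => v s *m 'J f' (x s))).
    by apply: filterS X1 => s ->.
  by rewrite (hess_jacobian _ _ oU' fs' xt) -DJ1 -Dv.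
split; first by case: (Xd t te xt).
  by case: X2.
rewrite derive1E; have [_ ->] := X2.
rewrite mulNmx (connection_change D (v t) (v t) xt) opprD [- _ - _]addrC subrK.
by rewrite (nbhs_singleton X1); exact: addNr.
Qed.

End GeodesicExistence.

(** * Curves in immersed submanifolds *)

Section ImmersedCurve.
Context {R : realType} {p q : nat}.

(** The little-o of the differential, with an explicit radius. *)
Lemma differentiable_bound (F : 'rV[R]_p -> 'rV[R]_q) (a : 'rV[R]_p) (e : R) :
  differentiable F a -> 0 < e ->
  exists2 d : R, 0 < d &
    forall z, `|z - a| < d -> `|F z - F a - (z - a) *m 'J F a| <= e * `|z - a|.
Proof.
move=> dF e0; have /diff_locally/eqaddoP/(_ e e0) H := dF.
have [d d0 Hd] := near_ball H.
exists d => // z za; have := Hd (z - a); rewrite subr0 => /(_ za).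
rewrite -![(_ + _ : _ -> _) _]/(_ + _) -![(- _ : _ -> _) _]/(- _) /= subrK.
rewrite opprD addrA; apply: le_trans.
by rewrite -deriveEjacobian// deriveE.
Qed.

Lemma mulmx_bound {k} (B : 'M[R]_(q, k)) :
  exists2 K : R, 0 < K & forall z : 'rV[R]_q, `|z *m B| <= K * `|z|.
Proof.
exists (1 + \sum_i \sum_j `|B i j|).
  by rewrite ltr_wpDr// sumr_ge0// => i _; rewrite sumr_ge0.
move=> z; apply: mx_norm_le => [|i j].
  by rewrite mulr_ge0// addr_ge0// sumr_ge0// => i _; rewrite sumr_ge0.
rewrite mxE (le_trans (ler_norm_sum _ _ _))// mulrDl mul1r ler_wpDl// mulr_suml.
apply: ler_sum => l _; rewrite normrM mulrC ler_pM ?ler_norm_entry//.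
by rewrite (bigD1 j)//= lerDl sumr_ge0.
Qed.

(** Write ds, dx for the increments of s and x over time h.  Multiplying
    dx = ds J + o(ds) by the right inverse B of J gives ds = dx B + o(ds).
    Continuity of s makes ds small, so ds is bounded by a multiple of dx, hence
    of h, and the remainder is o(h). *)
Lemma lift_derivable (F : 'rV[R]_p -> 'rV[R]_q) (s : R -> 'rV[R]_p) (x : R -> 'rV[R]_q)
    (t : R) (B : 'M[R]_(q, p)) :
  differentiable F (s t) -> 'J F (s t) *m B = 1%:M ->
  {for t, continuous s} -> (\forall r \near t, F (s r) = x r) ->
  derivable x t 1 -> is_derive t (1 : R) s ('D_1 x t *m B).
Proof.
move=> dF JB cs Fx dx.
have [dxB DxB] := is_derive_mulmxr B dx.
have [K K0 BK] := mulmx_bound B.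
have [N N0 xN] : exists2 N : R, 0 < N &
    \forall h \near (0 : R)^', `|x (h + t) - x t| <= N * `|h|.
  exists (`|'D_1 x t| + 1); first by rewrite ltr_wpDl.
  move/cvgrPdist_le : dx => /(_ 1 ltr01) H.
  near=> h.
  have h0 : h != 0 by near: h; exact: nbhs_dnbhs_neq.
  have : `|'D_1 x t - h^-1 *: (x (h *: 1 + t) - x t)| <= 1 by near: h; exact: H.
  rewrite [h *: 1]mulr1 => H1.
  rewrite -ler_pdivrMr ?normr_gt0//.
  have -> : `|x (h + t) - x t| / `|h| = `|h^-1 *: (x (h + t) - x t)|.
    by rewrite normrZ normfV mulrC.
  rewrite -(subrK ('D_1 x t) (h^-1 *: _)) addrC (le_trans (ler_normD _ _))// lerD2l.
  by rewrite distrC.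
suff H : (fun h : R => h^-1 *: ((s \o shift t) (h *: 1) - s t)) @ (0 : R)^' --> 'D_1 x t *m B.
  by split; [apply/cvg_ex; eexists; exact: H|exact: cvg_lim H].
have -> : (fun h : R => h^-1 *: ((s \o shift t) (h *: 1) - s t)) =
    (fun h : R => h^-1 *: (((fun r => x r *m B) \o shift t) (h *: 1) - x t *m B)) \+
    (fun h : R => h^-1 *: (s (h + t) - s t - (x (h + t) - x t) *m B)).
  apply/funext => h /=; rewrite [h *: 1]mulr1 -scalerDr; congr (_ *: _).
  by rewrite mulmxBl [RHS]addrC subrK.
rewrite -['D_1 x t *m B]addr0; apply: cvgD; first by rewrite -DxB; exact: dxB.
apply/cvgrPdist_le => /= e e0.
(* The first bound absorbs K * eta * |ds| into the left-hand side, giving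
   |ds| <= 2 K |dx|; with |dx| <= N |h| the second makes the remainder at most
   e |h|. *)
pose eta := Num.min ((2 * K)^-1) (e / (2 * K * K * N)).
have eta0 : 0 < eta by rewrite lt_min invr_gt0 divr_gt0 ?mulr_gt0.
have half_gt0 (z : R) : 0 < z -> 0 < z / 2 by move=> z0; rewrite divr_gt0.
have [d d0 Fd] := differentiable_bound dF eta0.
have [d1 d10 sd] : exists2 d1 : R, 0 < d1 & forall r, `|r - t| < d1 -> `|s r - s t| < d.
  have [d1 d10 Hd1] := continuous_ball cs (half_gt0 _ d0).
  exists d1 => // r /Hd1 /le_lt_trans; apply.
  by rewrite ltr_pdivrMr// ltr_pMr// ltr1n.
have [d2 d20 xd2] := near_ball Fx.
near=> h.
have h0 : h != 0 by near: h; exact: nbhs_dnbhs_neq.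
have hd1 : `|h| < d1 by near: h; exact: dnbhs0_lt.
have hd2 : `|h| < d2 by near: h; exact: dnbhs0_lt.
have hN : `|x (h + t) - x t| <= N * `|h| by near: h.
set ds := s (h + t) - s t; set dxx := x (h + t) - x t.
have sb : `|ds| < d by apply: sd; rewrite addrK.
have F1 : F (s (h + t)) = x (h + t) by apply: xd2; rewrite addrK.
have F0 : F (s t) = x t by exact: nbhs_singleton Fx.
have := Fd _ sb; rewrite F1 F0 -/ds -/dxx => o1.
rewrite -/dxx in hN; clearbody ds dxx.
have E : ds - dxx *m B = - ((dxx - ds *m 'J F (s t)) *m B).
  by rewrite mulmxBl -mulmxA JB mulmx1 opprB.
have o2 : `|ds - dxx *m B| <= K * (eta * `|ds|).
  by rewrite E normrN (le_trans (BK _))// ler_wpM2l// ltW.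
have dsb : `|ds| <= 2 * K * `|dxx|.
  have k1 : K * eta <= 2^-1.
    by rewrite mulrC -ler_pdivlMr// -invfM mulrC /eta ge_min [_ * K]mulrC lexx orTb.
  have k2 : K * (eta * `|ds|) <= 2^-1 * `|ds| by rewrite mulrA ler_wpM2r.
  have k3 : `|ds| <= `|ds - dxx *m B| + `|dxx *m B|.
    by rewrite -{1}(subrK (dxx *m B) ds) ler_normD.
  have k4 := BK dxx.
  lra.
rewrite sub0r normrN normrZ normfV ler_pdivrMl ?normr_gt0//.
apply: le_trans o2 _.
have k5 : eta * (2 * K * K * N) <= e by rewrite -ler_pdivlMr ?mulr_gt0// ge_min lexx orbT.
apply: (@le_trans _ _ (K * eta * (2 * K * (N * `|h|)))).
  rewrite [leLHS]mulrA; apply: ler_wpM2l; first by rewrite mulr_ge0// ltW.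
  by apply: le_trans dsb _; apply: ler_wpM2l => //; rewrite mulr_ge0// ltW.
rewrite [leRHS]mulrC.
have -> : K * eta * (2 * K * (N * `|h|)) = eta * (2 * K * K * N) * `|h| by ring.
by rewrite ler_wpM2r.
Unshelve. all: by end_near. Qed.

(** Near 0, s' = x' B(s) with B the smooth right inverse of J, so that
    x' = (x' B(s)) J(s).  The first factor is differentiable at 0, although s
    is only assumed continuous, and differentiating the product gives
    x'' = (x' B(s))' J + d^2F(v, v). *)
Lemma immersed_curve_acceleration (U : set 'rV[R]_p) (F : 'rV[R]_p -> 'rV[R]_q)
    (s : R -> 'rV[R]_p) (x : R -> 'rV[R]_q) (v : 'rV[R]_p) :
  open U -> smooth_on U F -> (forall u, U u -> row_free ('J F u)) ->
  (\forall t \near 0, [/\ U (s t), {for t, continuous s}, F (s t) = x t &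
    derivable x t 1]) ->
  derivable (derive1 x) 0 1 -> derive1 x 0 = v *m 'J F (s 0) ->
  (derive1 (derive1 x) 0 - hess F (s 0) v v <= 'J F (s 0))%MS.
Proof.
move=> oU Fs fF Hn d2x x'0.
pose B u := rinv ('J F u).
have Js := smooth_on_jacobian oU Fs.
have Bs : smooth_on U B by exact: smooth_on_rinv oU fF Js.
have JB u : U u -> 'J F u *m B u = 1%:M by move=> /fF; exact: mulmx_rinv.
have sd : \forall t \near 0, is_derive t (1 : R) s (derive1 x t *m B (s t)).
  have := near_join Hn; apply: filterS => t Ht.
  have [Ut ct _ dx] := nbhs_singleton Ht; rewrite derive1E.
  apply: lift_derivable ct _ dx; [exact: smooth_on_differentiable oU Fs Ut|exact: JB|].
  by apply: filterS Ht => r [].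
have xE : {near 0, derive1 x =1 (fun t => (derive1 x t *m B (s t)) *m 'J F (s t))}.
  apply: filterS2 (near_join Hn) sd => t Ht [ds Ds].
  have [Ut ct _ dx] := nbhs_singleton Ht.
  have dF := smooth_on_differentiable oU Fs Ut.
  rewrite {1}derive1E (mulmx_jacobian _ oU Fs Ut) -Ds.
  have [_ <-] := is_derive_curve ds dF; apply: near_eq_derive.
  by apply: filterS Ht => r [].
have [U0 c0 _ dx0] := nbhs_singleton Hn.
have [ds0 Ds0] := nbhs_singleton sd.
have aB : derive1 x 0 *m B (s 0) = v by rewrite x'0 -mulmxA JB// mulmx1.
rewrite aB in Ds0.
have [dBs _] := is_derive_curve ds0 (smooth_on_differentiable oU Bs U0).
have [dJs DJs] := is_derive_curve ds0 (smooth_on_differentiable oU Js U0).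
have [da _] := is_derive_mulmx d2x dBs.
have [_ Dm] := is_derive_mulmx da dJs.
have E3 : derive1 x 0 *m B (s 0) *m 'D_1 ((fun u => 'J F u) \o s) 0 = hess F (s 0) v v.
  rewrite aB DJs Ds0; exact: esym (hess_jacobian v v oU Fs U0).
have -> : derive1 (derive1 x) 0 =
    'D_1 (fun t => derive1 x t *m B (s t)) 0 *m 'J F (s 0) + hess F (s 0) v v.
  rewrite derive1E; apply: etrans (near_eq_derive (1 : R) xE) (etrans Dm _).
  exact: (congr1 (+%R _) E3).
by rewrite addrK submxMl.
Qed.

End ImmersedCurve.

(** * Totally geodesic hypersurfaces *)

Section TotallyGeodesic.
Context {R : realType} {m : nat} {M : manifold R m.+1}.
Variables (D : affine_connection M) (V : hypersurface M).
Implicit Types (c : chart V) (d : chart M).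

Let oL c d : open (local_dom (incl V) c d).
Proof. exact/open_local_dom/incl_continuous. Qed.

Let Fs c d : smooth_on (local_dom (incl V) c d) (local_expr (incl V) c d).
Proof. exact: incl_smooth. Qed.

(** D_v w for fields on V with constant components v and w in the chart c, in
    the components of the chart d.  Modulo the tangent hyperplane it is the
    second fundamental form; when tangent, it gives the induced connection. *)
Definition ambient_cov c d (u v w : 'rV[R]_m) : 'rV[R]_m.+1 :=
  cov_hess (local_expr (incl V) c d) (D d (local_expr (incl V) c d u)) u v w.

(** A geodesic with initial velocity v stays in V, so its acceleration in
    coordinates is d^2F(v, v) up to a tangent vector, while the geodesic
    equation makes it - Gamma(v, v). *)
Lemma ambient_cov_diag_tangent c d u v : totally_geodesic D V ->
  local_dom (incl V) c d u -> (ambient_cov c d u v v <= tangent_mx c d u)%MS.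
Proof.
move=> geo du; have /local_domP[cu ipd] := du.
pose F := local_expr (incl V) c d.
have [e [crv [gcrv crv0 v0]]] := geodesic_exists D (v *m 'J F u) (local_expr_cod du).
rewrite param_local_expr// in crv0.
have tv : (derive1 (coord M d \o crv) 0 <= tangent_mx c d (coord V c (param V c u)))%MS.
  by rewrite v0 paramK// /tangent_mx submxMl.
have [delta [sigma [delta0 sigma0 Hs]]] :=
  geo e crv (param V c u) c d (cod_param cu) ipd gcrv crv0 tv.
have [e0 Hg] := gcrv.
pose x := coord M d \o crv.
pose s t := coord V c (sigma t).
have s0 : s 0 = u by rewrite /s sigma0 paramK.
have n0 : `|0 : R| < delta by rewrite normr0.
have n0e : `|0 : R| < e by rewrite normr0.
have [sc0 _] := Hs 0 n0.
have Hn : \forall t \near 0, [/\ local_dom (incl V) c d (s t), {for t, continuous s},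
    F (s t) = x t & derivable x t 1].
  have c1 : \forall t \near 0, dom V c (sigma t).
    apply: sc0; apply: (open_nbhs_nbhs (conj (dom_open c) _)).
    by rewrite /= sigma0; exact: cod_param.
  have c2 : \forall t \near 0, dom M d (crv t).
    have [cc _] := Hg 0 n0e; apply: cc.
    by apply: (open_nbhs_nbhs (conj (dom_open d) _)); rewrite /= crv0.
  near=> t.
  have te : `|t| < e by near: t; exact: near_ball0.
  have td : `|t| < delta by near: t; exact: near_ball0.
  have ct : dom V c (sigma t) by near: t.
  have dt : dom M d (crv t) by near: t.
  have [st ist] := Hs t td; have [_ /(_ d dt)[dx _ _]] := Hg t te.
  split=> //.
  - apply/local_domP; split; first exact: cod_coord.
    by rewrite /s coordK// ist.
  - by apply: continuous_comp; [exact: st|exact: coord_continuous].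
  - by rewrite /F /local_expr /= /s coordK// ist.
have [_ /(_ d)] := Hg 0 n0e; rewrite crv0 => /(_ ipd)[_ d2x geq].
have x'0 : derive1 x 0 = v *m 'J F (s 0) by rewrite s0.
have := immersed_curve_acceleration (@oL c d) (@Fs c d)
  (@incl_immersion _ _ _ V c d) Hn d2x x'0.
rewrite s0 => acc.
have F0 : x 0 = F u by rewrite /x /= crv0.
move: geq; rewrite -/x F0 x'0 s0 => /eqP; rewrite addr_eq0 => /eqP geq.
rewrite /ambient_cov /cov_hess -(opprK (gamma _ _ _)) -geq -opprB.
by rewrite (eqmx_opp _).
Unshelve. all: by end_near. Qed.

(** Polarization: twice the form on (v, w) is a difference of values on the
    diagonal, by symmetry. *)
Lemma ambient_cov_tangent c d u v w : totally_geodesic D V ->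
  (forall a b, gamma (D d (local_expr (incl V) c d u)) a b =
     gamma (D d (local_expr (incl V) c d u)) b a) ->
  local_dom (incl V) c d u -> (ambient_cov c d u v w <= tangent_mx c d u)%MS.
Proof.
move=> geo Ds du.
have S2 : ambient_cov c d u v w *+ 2 =
    ambient_cov c d u (v + w) (v + w) - ambient_cov c d u v v - ambient_cov c d u w w.
  rewrite /ambient_cov (cov_hessDl _ (@oL c d) (@Fs c d) du) !(cov_hessDr _ (@oL c d) (@Fs c d) du).
  rewrite (cov_hess_sym (@oL c d) (@Fs c d) du Ds w v).
  move: (cov_hess _ _ _ v v) (cov_hess _ _ _ v w) (cov_hess _ _ _ w w) => x y z.
  by apply/rowP => j; rewrite !mxE; ring.
have H : (ambient_cov c d u v w *+ 2 <= tangent_mx c d u)%MS.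
  have diag a := ambient_cov_diag_tangent a geo du.
  by rewrite S2; apply: addmx_sub; [apply: addmx_sub|]; rewrite ?eqmx_opp; exact: diag.
by rewrite -scaler_nat (eqmx_scale _ _) ?pnatr_eq0 in H.
Qed.

End TotallyGeodesic.

(** * The induced connection *)

Section InducedConnection.
Context {R : realType} {m : nat} {M : manifold R m.+1}.
Variables (D : affine_connection M) (V : hypersurface M).
Implicit Types (c : chart V) (d : chart M).
Hypothesis tangent : forall c d u v w, local_dom (incl V) c d u ->
  (ambient_cov D (V := V) c d u v w <= tangent_mx c d u)%MS.

Let oL c d : open (local_dom (incl V) c d).
Proof. exact/open_local_dom/incl_continuous. Qed.

Let Fs c d : smooth_on (local_dom (incl V) c d) (local_expr (incl V) c d).
Proof. exact: incl_smooth. Qed.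

Let Tfree c d u : local_dom (incl V) c d u -> row_free (tangent_mx c d u).
Proof. exact: incl_immersion. Qed.

Let Tinj c d u k (A B : 'M[R]_(k, m)) : local_dom (incl V) c d u ->
  A *m tangent_mx c d u = B *m tangent_mx c d u -> A = B.
Proof. by move=> /Tfree /row_free_inj; apply. Qed.

Lemma ambient_cov_target c d d' u v w :
  local_dom (incl V) c d u -> local_dom (incl V) c d' u ->
  let J := 'J (transition d d') (local_expr (incl V) c d u) in
  tangent_mx c d' u = tangent_mx c d u *m J /\
  ambient_cov D c d' u v w = ambient_cov D c d u v w *m J.
Proof.
move=> du d'u J.
pose U := local_dom (incl V) c d `&` local_dom (incl V) c d'.
have oU : open U by apply: openI; exact: oL.
have sF : smooth_on U (local_expr (incl V) c d).
  by apply: smooth_on_sub (@Fs c d) => x [].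
have FU x : U x -> overlap d d' (local_expr (incl V) c d x).
  by move=> [dx d'x]; case: (local_expr_target dx d'x).
have HE x : U x -> local_expr (incl V) c d' x = transition d d' (local_expr (incl V) c d x).
  by move=> [dx d'x]; case: (local_expr_target dx d'x).
have Uu : U u by [].
split.
  exact: chain_jacobian oU (@open_overlap _ _ _ d d') sF (@smooth_transition _ _ _ d d') FU HE _ Uu.
apply: (cov_hess_postcomp oU (@open_overlap _ _ _ d d') sF
  (@smooth_transition _ _ _ d d') FU HE Uu).
move=> a b; rewrite HE//; apply: connection_change; exact: FU.
Qed.

Lemma ambient_cov_source c c' d u v w :
  local_dom (incl V) c d u -> overlap c c' u ->
  let u' := transition c c' u in let J := 'J (transition c c') u in
  tangent_mx c d u = J *m tangent_mx c' d u' /\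
  ambient_cov D c d u v w = hess (transition c c') u v w *m tangent_mx c' d u' +
    ambient_cov D c' d u' (v *m J) (w *m J).
Proof.
move=> du cc'u u' J.
pose U := local_dom (incl V) c d `&` overlap c c'.
have oU : open U by apply: openI; [exact: oL|exact: open_overlap].
have sf : smooth_on U (transition c c').
  by apply: smooth_on_sub (@smooth_transition _ _ _ c c') => x [].
have FU x : U x -> local_dom (incl V) c' d (transition c c' x).
  by move=> [dx cx]; case: (local_expr_source dx cx).
have HE x : U x -> local_expr (incl V) c d x = local_expr (incl V) c' d (transition c c' x).
  by move=> [dx cx]; case: (local_expr_source dx cx).
have Uu : U u by [].
split; first exact: chain_jacobian oU (@oL c' d) sf (@Fs c' d) FU HE _ Uu.
rewrite /ambient_cov HE//.
exact: cov_hess_precomp oU (@oL c' d) sf (@Fs c' d) FU HE Uu _ _ _.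
Qed.

Lemma smooth_on_ambient_cov c d v w :
  smooth_on (local_dom (incl V) c d) (fun u => ambient_cov D c d u v w).
Proof.
apply: smooth_onD; [exact: oL|exact: smooth_on_hess (@oL c d) (@Fs c d)|].
apply: smooth_on_gamma; first exact: oL.
- move=> k; apply: (smooth_on_comp (@oL c d) (@open_cod _ _ _ d) _ (conn_smooth D d k)).
    by move=> u; exact: local_expr_cod.
  exact: Fs.
- exact: smooth_on_mulmx_jacobian (@oL c d) (@Fs c d).
- exact: smooth_on_mulmx_jacobian (@oL c d) (@Fs c d).
Qed.

(** The coefficients of the connection induced through the chart d: they solve
    Gamma^V(v, w) T = D_v w. *)
Definition local_coef c d (u : 'rV[R]_m) (k : 'I_m) : 'M[R]_m :=
  \matrix_(i, j) (ambient_cov D c d u (delta_mx 0 i) (delta_mx 0 j)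
                    *m rinv (tangent_mx c d u)) 0 k.

Lemma gamma_local_coef c d u v w : local_dom (incl V) c d u ->
  gamma (local_coef c d u) v w *m tangent_mx c d u = ambient_cov D c d u v w.
Proof.
move=> du; rewrite -[RHS](mulmx_rinvK (Tfree du) (tangent v w du)); congr (_ *m _).
rewrite gamma_sum /ambient_cov (cov_hess_sum _ (@oL c d) (@Fs c d) du) mulmx_suml.
apply: eq_bigr => i _; rewrite mulmx_suml; apply: eq_bigr => j _.
rewrite -scalemxAl; congr (_ *: _); apply/rowP => k.
by rewrite gamma_delta mxE.
Qed.

(** Both sides solve the same linear system, and T is injective on rows. *)
Lemma local_coef_target c d d' u :
  local_dom (incl V) c d u -> local_dom (incl V) c d' u ->
  local_coef c d u = local_coef c d' u.
Proof.
move=> du d'u; apply: gamma_inj => v w; apply: (Tinj d'u).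
have [TE SE] := ambient_cov_target v w du d'u.
apply: etrans _ (esym (gamma_local_coef v w d'u)).
by rewrite TE SE mulmxA (gamma_local_coef v w du).
Qed.

Lemma smooth_on_local_coef c d k :
  smooth_on (local_dom (incl V) c d) (fun u => local_coef c d u k).
Proof.
apply/(smooth_on_mxP _ (@oL c d)) => i j; under eq_fun do rewrite mxE.
apply: (smooth_on_mxP (fun u => ambient_cov D c d u (delta_mx 0 i) (delta_mx 0 j)
                    *m rinv (tangent_mx c d u)) (@oL c d)).1.
apply: smooth_on_mulmx; first exact: oL.
  exact: smooth_on_ambient_cov.
apply: smooth_on_rinv; [exact: oL|by move=> u; exact: Tfree|].
exact: smooth_on_jacobian (@oL c d) (@Fs c d).
Qed.

(** Connection coefficients on V must be given without reference to an ambient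
    chart, so one is chosen around each point; by [local_coef_target] the
    choice is immaterial. *)
Definition target_chart (c : chart V) (u : 'rV[R]_m) : chart M :=
  projT1 (cid (dom_cover (incl V (param V c u)))).

Lemma target_chartP c u : cod c u -> local_dom (incl V) c (target_chart c u) u.
Proof.
move=> cu; apply/local_domP; split=> //.
exact: (projT2 (cid (dom_cover (incl V (param V c u))))).
Qed.

Definition induced_coef c u := local_coef c (target_chart c u) u.

Lemma induced_coefE c d u : local_dom (incl V) c d u ->
  induced_coef c u = local_coef c d u.
Proof.
move=> du; apply: local_coef_target => //.
by apply: target_chartP; have /local_domP[] := du.
Qed.

Lemma induced_coef_smooth c k : smooth_on (cod c) (fun u => induced_coef c u k).
Proof.
apply: smooth_on_local => u cu; exists (local_dom (incl V) c (target_chart c u)).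
  exact: target_chartP.
apply: eq_smooth_on (@oL _ _) _ (@smooth_on_local_coef c (target_chart c u) k) => x dx.
by rewrite (induced_coefE dx).
Qed.

(** Multiplied by the tangent matrix, the law is the change of D_v w under a
    change of chart of V. *)
Lemma induced_coef_change c c' u v w : overlap c c' u ->
  gamma (induced_coef c u) v w *m 'J (transition c c') u =
    'D_v (fun x => w *m 'J (transition c c') x) u +
    gamma (induced_coef c' (transition c c' u))
      (v *m 'J (transition c c') u) (w *m 'J (transition c c') u).
Proof.
move=> cc'u; have du := target_chartP (overlap_cod cc'u).
set d := target_chart c u in du.
have [d'u _] := local_expr_source du cc'u.
apply: (Tinj d'u); rewrite (induced_coefE du) (induced_coefE d'u).
have [TE SE] := ambient_cov_source v w du cc'u.
rewrite mulmxDl gamma_local_coef// -/(hess _ _ _ _) -SE -mulmxA -TE.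
exact: gamma_local_coef.
Qed.

Definition induced : affine_connection V :=
  @AffineConnection R m V induced_coef induced_coef_smooth induced_coef_change.

Lemma gamma_induced c d u v w : local_dom (incl V) c d u ->
  gamma (induced c u) v w *m tangent_mx c d u = ambient_cov D c d u v w.
Proof. by move=> du; rewrite [induced c u](induced_coefE du) gamma_local_coef. Qed.

(** The induced derivative is the restriction of the ambient one. *)
Lemma cov_induced c d u X (Y : 'rV[R]_m -> 'rV[R]_m) : local_dom (incl V) c d u ->
  derivable Y u X ->
  cov induced c id X Y u *m tangent_mx c d u =
    cov D d (local_expr (incl V) c d) X (fun x => Y x *m tangent_mx c d x) u.
Proof.
move=> du dY; rewrite cov_id mulmxDl (gamma_induced _ _ du) /cov.
have dT := smooth_on_derivable (v := X) (smooth_on_jacobian (@oL c d) (@Fs c d)) du.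
rewrite (derive_mulmx dY dT) -addrA; congr (_ + _).
rewrite /ambient_cov /cov_hess; congr (_ + _).
exact: hess_jacobian (@oL c d) (@Fs c d) du.
Qed.

End InducedConnection.

(** * Curvature of the induced connection *)

(** The algebra behind the equality of curvatures: the symmetric second
    derivatives dX = dY and hXY = hYX cancel, as do the mixed terms in hXZ and
    hYZ. *)
Lemma curvature_cancellation {R : realType} {q : nat} (G : 'I_q -> 'M[R]_q)
    (X Y Z rX rY dX dY sXZ sYZ hXY hYX hXZ hYZ : 'rV[R]_q) :
  dX = dY -> sXZ = hXZ + gamma G X Z -> sYZ = hYZ + gamma G Y Z -> hYX = hXY ->
  dX + (rX + gamma G hXY Z + gamma G Y hXZ) + gamma G X sYZ -
    (dY + (rY + gamma G hYX Z + gamma G X hYZ) + gamma G Y sXZ) =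
  (rX + gamma G X (gamma G Y Z)) - (rY + gamma G Y (gamma G X Z)).
Proof.
move=> -> -> -> ->; rewrite !gammaDr.
move: (gamma G hXY Z) (gamma G Y hXZ) (gamma G X hYZ) => a1 a2 a3.
move: (gamma G X _) (gamma G Y _) => a4 a5.
by apply/rowP => j; rewrite !mxE; ring.
Qed.

Section Curvature.
Context {R : realType} {m : nat} {M : manifold R m.+1}.
Variables (D : affine_connection M) (V : hypersurface M).
Hypothesis tangent : forall (c : chart V) (d : chart M) u v w, local_dom (incl V) c d u ->
  (ambient_cov D (V := V) c d u v w <= tangent_mx c d u)%MS.

(** Product rule for d^2F(Y, Z) + Gamma(F)(dF Y, dF Z). *)
Lemma derive_ambient_cov c d u X Y Z : local_dom (incl V) c d u ->
  let y := local_expr (incl V) c d u in let T := tangent_mx c d u in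
  let h := hess (local_expr (incl V) c d) u in
  'D_X (fun x => ambient_cov D c d x Y Z) u =
    'D_X (fun x => hess (local_expr (incl V) c d) x Y Z) u +
    (gamma (fun j => 'D_(X *m T) (fun x => D d x j) y) (Y *m T) (Z *m T) +
     gamma (D d y) (h X Y) (Z *m T) + gamma (D d y) (Y *m T) (h X Z)).
Proof.
move=> du y T h.
have oL : open (local_dom (incl V) c d) by exact/open_local_dom/incl_continuous.
have Fs := @incl_smooth _ _ _ V c d.
have dF := smooth_on_differentiable oL Fs du.
have dh := smooth_on_derivable (v := X) (smooth_on_hess Y Z oL Fs) du.
have dY := smooth_on_derivable (v := X) (smooth_on_mulmx_jacobian Y oL Fs) du.
have dZ := smooth_on_derivable (v := X) (smooth_on_mulmx_jacobian Z oL Fs) du.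
have dj j : differentiable (fun x => D d x j) y.
  exact: smooth_on_differentiable (@open_cod _ _ _ d) (conn_smooth D d j) (local_expr_cod du).
have dA j : is_derive u X (fun x => D d (local_expr (incl V) c d x) j)
    ('D_(X *m T) (fun x => D d x j) y).
  split; first exact/diff_derivable/(differentiable_comp dF (dj j)).
  by apply: etrans (derive_comp X dF (dj j)) _; rewrite -(mulmx_jacobian X oL Fs du).
have [dg Dg] := is_derive_gamma (fun j => @ex_derive _ _ _ _ _ _ _ (dA j)) dY dZ.
have Ek : (fun j => 'D_X (fun x => D d (local_expr (incl V) c d x) j) u) =
    (fun j => 'D_(X *m T) (fun x => D d x j) y).
  by apply/funext => j; case: (dA j).
rewrite Ek in Dg.
exact: etrans (deriveD dh dg) (congr1 (+%R _) Dg).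
Qed.

(** Applying [cov_induced] twice expresses the induced curvature by derivatives
    of D_Y Z along V; the derivatives of Gamma appear only in the directions
    X T and Y T, as in the ambient curvature. *)
Lemma curvature_induced (c : chart V) (d : chart M) u X Y Z : local_dom (incl V) c d u ->
  let T := tangent_mx c d u in
  curvature (induced tangent) c u X Y Z *m T =
    curvature D d (local_expr (incl V) c d u) (X *m T) (Y *m T) (Z *m T).
Proof.
move=> du T; have /local_domP[cu _] := du.
have oL : open (local_dom (incl V) c d) by exact/open_local_dom/incl_continuous.
have Fs := @incl_smooth _ _ _ V c d.
rewrite (curvatureE D _ _ _ (local_expr_cod du)).
set nabla := induced tangent; set F := local_expr (incl V) c d.
have inner Y' : cov nabla c id Y' (cst Z) = (fun x => gamma (nabla c x) Y' Z).
  by apply/funext => x; rewrite cov_id derive_cst add0r.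
have outer X' Y' : cov nabla c id X' (cov nabla c id Y' (cst Z)) u *m T =
    'D_X' (fun x => ambient_cov D c d x Y' Z) u +
    gamma (D d (F u)) (X' *m T) (ambient_cov D c d u Y' Z).
  rewrite inner.
  have dg : derivable (fun x => gamma (nabla c x) Y' Z) u X'.
    apply: (smooth_on_derivable (U := cod c)) cu.
    apply: smooth_on_gamma; [exact: open_cod| |exact: smooth_on_cst|exact: smooth_on_cst].
    by move=> k; exact: conn_smooth.
  have E : {near u, (fun x => gamma (nabla c x) Y' Z *m tangent_mx c d x) =1
                    (fun x => ambient_cov D c d x Y' Z)}.
    by apply: (near_open oL du) => x dx; exact: gamma_induced.
  rewrite (cov_induced tangent du dg) /cov (near_eq_derive X' E).
  by congr (_ + gamma _ _ _); exact: gamma_induced.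
rewrite /curvature mulmxBl !outer !derive_ambient_cov// -/T -/F.
have S1 : 'D_X (fun x => hess F x Y Z) u = 'D_Y (fun x => hess F x X Z) u.
  exact: schwarz oL (smooth_on_mulmx_jacobian Z oL Fs) du.
have SE a b : ambient_cov D c d u a b =
    hess F u a b + gamma (D d (F u)) (a *m T) (b *m T) by [].
have hs : hess F u Y X = hess F u X Y := hess_sym Y X oL Fs du.
exact: (curvature_cancellation _ _ S1 (SE X Z) (SE Y Z) hs).
Qed.

End Curvature.

(** * Isotropic normalizations and isotropic frames *)

Section Projection.
Context {R : realType}.

(** A line that meets a subspace outside 0 is contained in it. *)
Lemma cap_line_eq0 {p q} (T : 'M[R]_(p, q)) (v : 'rV[R]_q) : ~~ (v <= T)%MS ->
  (<<T>> :&: <<v>> = 0)%MS.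
Proof.
move=> vT; apply/eqP; apply: contraNT vT => cap0.
have capv : (<<T>> :&: <<v>> <= v)%MS by rewrite (submx_trans (capmxSr _ _))// genmxE.
have vcap : (v <= <<T>> :&: <<v>>)%MS.
  have [_ <-] := mxrank_leqif_sup capv.
  rewrite eqn_leq mxrankS//= (leq_trans (rank_leq_row _))//.
  by rewrite lt0n mxrank_eq0.
by rewrite (submx_trans vcap)// (submx_trans (capmxSl _ _))// genmxE.
Qed.

Lemma proj_tangent {p q} (T : 'M[R]_(p, q)) (v w : 'rV[R]_q) :
  ~~ (v <= T)%MS -> (w <= T)%MS -> w *m proj_mx <<T>>%MS <<v>>%MS = w.
Proof.
move=> vT wT; apply: proj_mx_id; first exact: cap_line_eq0.
by rewrite genmxE.
Qed.

End Projection.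

Section InducedIsInduced.
Context {R : realType} {n : nat} {M : manifold R n.+2} {g : lorentz_metric M}.
Variables (D : affine_connection M) (V : hypersurface M).
Hypothesis tangent : forall (c : chart V) (d : chart M) u v w, local_dom (incl V) c d u ->
  (ambient_cov D (V := V) c d u v w <= tangent_mx c d u)%MS.
Variable N : isotropic_normalization g V.

(** D_X Y is already tangent, so its projection along the normalizing direction
    is D_X Y itself. *)
Lemma induced_is_induced : induced_connection D N (induced tangent).
Proof.
move=> c d p W X Y cp dp oW Wu Ys u.
have du : local_dom (incl V) c d u.
  by apply/local_domP; rewrite /u coordK//; split=> //; exact: cod_coord.
have dY := smooth_on_derivable (v := X) Ys Wu.
rewrite -(cov_induced tangent du dY).
by rewrite proj_tangent// ?submxMl//; exact: norm_transversal.
Qed.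

(** Fields with constant components determine the connection coefficients. *)
Lemma induced_unique (nabla : affine_connection V) : induced_connection D N nabla ->
  forall (c : chart V) (u : 'rV[R]_n.+1), cod c u -> nabla c u = induced tangent c u.
Proof.
move=> Hn c u cu; apply: gamma_inj => v w.
have du := target_chartP cu; set d := target_chart c u in du.
have /local_domP[_ dp] := du.
apply: (row_free_inj (incl_immersion du)).
have H (A : affine_connection V) := fun HA : induced_connection D N A =>
  HA c d (param V c u) setT v (cst w) (cod_param cu) dp openT I (@smooth_on_cst _ _ _ setT w).
have := etrans (H _ Hn) (esym (H _ induced_is_induced)); rewrite /= paramK//.
by rewrite !cov_id derive_cst !add0r.
Qed.

End InducedIsInduced.

Section SecondFundamental.
Context {R : realType} {n : nat} {M : manifold R n.+2} (g : lorentz_metric M).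
Variables (D : affine_connection M) (V : hypersurface M).
Hypothesis tangent : forall (c : chart V) (d : chart M) u v w, local_dom (incl V) c d u ->
  (ambient_cov D (V := V) c d u v w <= tangent_mx c d u)%MS.

(** A tangent field is Y T with Y = e T^t (T T^t)^-1 smooth, and its ambient
    derivative is the induced derivative of Y times T. *)
Lemma cov_tangent c d (W : set 'rV[R]_n.+1) (e : 'rV[R]_n.+1 -> 'rV[R]_n.+2) u X :
  open W -> W `<=` local_dom (incl V) c d -> smooth_on W e ->
  (forall x, W x -> (e x <= tangent_mx c d x)%MS) -> W u ->
  (cov D d (local_expr (incl V) c d) X e u <= tangent_mx c d u)%MS.
Proof.
move=> oW WL es eT Wu; have du := WL _ Wu.
pose Y x := e x *m rinv (tangent_mx c d x).
have Ts : smooth_on W (fun x => tangent_mx c d x).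
  apply: smooth_on_sub WL _; apply: smooth_on_jacobian; last exact: incl_smooth.
  exact/open_local_dom/incl_continuous.
have Tfree x : W x -> row_free (tangent_mx c d x) by move=> /WL; exact: incl_immersion.
have Ys : smooth_on W Y.
  by apply: smooth_on_mulmx => //; exact: smooth_on_rinv.
have eE x : W x -> Y x *m tangent_mx c d x = e x.
  by move=> Wx; apply: mulmx_rinvK; [exact: Tfree|exact: eT].
have -> : cov D d (local_expr (incl V) c d) X e u =
    cov D d (local_expr (incl V) c d) X (fun x => Y x *m tangent_mx c d x) u.
  by apply: near_eq_cov; apply: (near_open oW Wu) => x Wx; rewrite eE.
by rewrite -(cov_induced tangent du (smooth_on_derivable Ys Wu)) submxMl.
Qed.

(** The derivative of e_a is a combination of e_1, ..., e_(n-1), which span the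
    tangent hyperplane, so its coordinate on e_n is 0. *)
Lemma second_fundamental_tensor_eq0 (c : chart V) (d : chart M) (W : set 'rV[R]_n.+1)
    (E : 'rV[R]_n.+1 -> 'M[R]_n.+2) : isotropic_frame g c d W E ->
  forall u, W u -> second_fundamental_tensor D c d E u = 0.
Proof.
move=> [oW WL Es HE] u Wu; apply/matrixP => a b; rewrite !mxE /conn_form.
(* The vectors e_a are among the rows kept by [row' ord_max]. *)
have midE : mid a = lift ord_max (lift ord0 a).
  by apply/ord_inj; rewrite /mid lift0 !lift_max lift0.
have rowT x : W x -> (row (mid a) (E x) <= tangent_mx c d x)%MS.
  move=> /HE[[_ /eqmxP ET] _ _ _ _].
  by rewrite -ET midE -row_rowsub row_sub.
have re : smooth_on W (fun x => row (mid a) (E x)).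
  apply/(smooth_on_mxP _ oW) => i j; under eq_fun do rewrite mxE.
  exact: (smooth_on_mxP _ oW).1.
have [[Eu /eqmxP ET] _ _ _ _] := HE u Wu.
have := cov_tangent (row (mid b) (E u) *m pinvmx (tangent_mx c d u)) oW WL re rowT Wu.
rewrite -ET => /submxP[z ->].
have -> : row' ord_max (E u) = (row' ord_max 1%:M) *m E u.
  apply/matrixP => k l; rewrite [RHS]mxE (bigD1 (lift ord_max k))//= !mxE eqxx mul1r.
  by rewrite big1 ?addr0// => j jk; rewrite !mxE eq_sym (negbTE jk) mul0r.
rewrite mulmxA mulmxK// mxE big1// => j _.
by rewrite !mxE eq_sym (negbTE (neq_lift _ _)) mulr0.
Qed.

End SecondFundamental.

Theorem theorem7 (R : realType) (n : nat) (M : manifold R n.+2)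
  (g : lorentz_metric M) (D : affine_connection M) (hD : levi_civita g D)
  (V : hypersurface M) (hV : lightlike g V) (hgeo : totally_geodesic D V) :
  (forall (c : chart V) (d : chart M) (W : set 'rV[R]_n.+1)
      (E : 'rV[R]_n.+1 -> 'M[R]_n.+2),
    isotropic_frame g c d W E ->
    forall u, W u -> second_fundamental_tensor D c d E u = 0) /\
  (forall N : isotropic_normalization g V,
    exists nabla : affine_connection V,
      [/\ induced_connection D N nabla,
          (forall nabla' : affine_connection V,
            induced_connection D N nabla' ->
            forall (c : chart V) (u : 'rV[R]_n.+1), cod c u ->
              nabla' c u = nabla c u) &
          (forall (c : chart V) (d : chart M) (u X Y Z : 'rV[R]_n.+1),
            local_dom (incl V) c d u ->
            let T := tangent_mx c d u in
            curvature nabla c u X Y Z *m T =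
              curvature D d (local_expr (incl V) c d u)
                (X *m T) (Y *m T) (Z *m T))]).
Proof.
have tangent (c : chart V) (d : chart M) u v w : local_dom (incl V) c d u ->
    (ambient_cov D c d u v w <= tangent_mx c d u)%MS.
  move=> du; apply: ambient_cov_tangent => // a b.
  by have [-> ] := hD d _ (local_expr_cod du).
split; first by move=> c d W E; exact: second_fundamental_tensor_eq0.
move=> N; exists (induced tangent); split.
- exact: induced_is_induced.
- exact: induced_unique.
- by move=> c d u X Y Z; exact: curvature_induced.
Qed.
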